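(* Let $\Sigma$ be a finite simplicial complex on $[0,n]$ and let $i\geqslant0$. For any $U\in\mathcal{B}(\Sigma,i+1)$ we have $$(\ast)\qquad \partial\circ\Delta_i^U-(-1)^i\,\Delta_i^U\circ\partial=(1+(-1)^iT)\,\Delta_{i-1}^{\emptyset}$$ as maps $C_\bullet(\Sigma)\to C_\bullet(\Sigma)\otimes C_\bullet(\Sigma)$. Moreover, any coproduct $\Delta'_i\colon C_\bullet(\Sigma)\to C_\bullet(\Sigma)\otimes C_\bullet(\Sigma)$ (degree-$i$ linear map) which satisfies the formula $(\ast)$ (with $\Delta'_i$ in place of $\Delta_i^U$), for which $\Delta'_i(\sigma)=\sigma\otimes\sigma$ for all $\sigma\in\Sigma_0$ if $i=0$, and which otherwise (that is, if $i>0$) has a minimal number of terms, is of the form $\Delta'_i=\Delta_i^U$ for some $U\in\mathcal{B}(\Sigma,i+1)$.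
   Context: Notation. $[0,n]=\{0,\dots,n\}$. $\binom{S}{k}$ is the set of $k$-element subsets of $S$; $|S|$ is the cardinality; $|S|_{<x}=|\{s\in S: s<x\}|$, $|S|_{>x}=|\{s\in S:s>x\}|$. A finite simplicial complex on $[0,n]$ is a set $\Sigma$ of non-empty subsets of $[0,n]$ such that every non-empty subset of an element of $\Sigma$ is in $\Sigma$. $\Sigma_p$ is the set of $p$-simplices, i.e. $\sigma\in\Sigma$ with $|\sigma|=p+1$. $C_\bullet(\Sigma)$ is the chain complex of free $\mathbb{Z}$-modules with $C_p(\Sigma)$ having basis $\Sigma_p$ and $\partial\{v_0<\dots<v_q\}=\sum_{p=0}^q(-1)^p\{v_0,\dots,\hat v_p,\dots,v_q\}$ for $q\geqslant1$, $\partial=0$ in degree $0$. On the tensor product, $\partial(x\otimes y)=\partial x\otimes y+(-1)^{\deg x}x\otimes\partial y$ and $T(x\otimes y)=(-1)^{\deg x\deg y}\,y\otimes x$. The basis of $C_\bullet(\Sigma)\otimes C_\bullet(\Sigma)$ is $\{\sigma\otimes\tau:\sigma,\tau\in\Sigma\}$; the terms of an element are the basis elements occurring with non-zero coefficient. That $\Delta'_i$ has a minimal number of terms means that for every $\sigma\in\Sigma$ the number of terms of $\Delta'_i(\sigma)$ is minimal amongst coproducts satisfying $(\ast)$. $\mathcal{B}(\Sigma,i+1)$ is the set of $\Sigma$-consistent subsets $U\subseteq\Sigma_{i+1}$: for every $M=\{m_0<\dots<m_{i+2}\}\in\Sigma_{i+2}$, the set of $K\in U$ with $K\subset M$ is a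 beginning or an ending segment (possibly empty or everything) of $M\setminus m_{i+2}<\dots<M\setminus m_1<M\setminus m_0$. The coproduct $\Delta_i^U$. For $U\in\mathcal{B}(\Sigma,i+1)$, $\sigma\in\Sigma$ and $L\in\binom{\sigma}{i+1}$, let $A=A_L^{U,\sigma}$ be the set of $a\in\sigma\setminus L$ such that either $L\cup\{a\}\in U$ and $|L|_{>a}$ is even, or $L\cup\{a\}\notin U$ and $|L|_{>a}$ is odd; let $B=B_L^{U,\sigma}=\sigma\setminus(L\cup A)$. Then $$\Delta_i^U(\sigma)=\sum_{L\in\binom{\sigma}{i+1}}(-1)^{\varepsilon_\sigma(L,A,B)}\,(L\cup A)\otimes(L\cup B),\qquad \varepsilon_\sigma(L,A,B)=\sum_{b\in B}|A|_{<b}+\sum_{l\in L}|L|_{<l}+|\sigma|\,|A|,$$ (so $\Delta_i^U(\sigma)=0$ if $|\sigma|\leqslant i$), extended linearly. By convention $\Delta_{-1}^{\emptyset}=0$.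
   Formalization: For i=0 a minimal number of terms is also assumed (among coproducts satisfying (∗) with σ↦σ⊗σ on vertices), as the claim fails without it; for every i, Δ'_i(σ) need be minimal only against coproducts having no more terms than Δ'_i on the proper faces of σ. *)

(* Defs.v *)
From HB Require Import structures.
From mathcomp Require Import all_boot all_order all_algebra.

Set Implicit Arguments.
Unset Strict Implicit.
Unset Printing Implicit Defensive.

Import GRing.Theory.
Local Open Scope ring_scope.

Definition simplicial_complex n (S : {set {set 'I_n.+1}}) : Prop :=
  (forall s, s \in S -> s != set0) /\
  (forall s t : {set 'I_n.+1}, s \in S -> t != set0 -> t \subset s -> t \in S).

Definition simplices n (S : {set {set 'I_n.+1}}) (p : nat) : {set {set 'I_n.+1}} :=
  [set s in S | #|s| == p.+1].

Definition card_lt n (A : {set 'I_n.+1}) (x : 'I_n.+1) : nat :=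
  #|[set s in A | (s < x)%N]|.

Definition card_gt n (A : {set 'I_n.+1}) (x : 'I_n.+1) : nat :=
  #|[set s in A | (x < s)%N]|.

Definition sdim n (s : {set 'I_n.+1}) : nat := #|s|.-1.

Section Chains.

Variables (n : nat) (S : {set {set 'I_n.+1}}).

Definition simplex := {s : {set 'I_n.+1} | s \in S}.

(* The total modules of C(S) and of C(S) (x) C(S), as free Z-modules on their
   bases; the grading is the one carried by the basis elements. Additive maps
   between them are the Z-linear maps. *)
Definition chain := {ffun simplex -> int}.
Definition chain2 := {ffun simplex * simplex -> int}.

(* The basis element of chain given by the set A; it is 0 if A is not in S. *)
Definition cell (A : {set 'I_n.+1}) : chain := [ffun s => (val s == A)%:R].

Definition tensor (x y : chain) : chain2 := [ffun p => x p.1 * y p.2].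

Definition linext (I : finType) (V : zmodType) (f : I -> V)
    (c : {ffun I -> int}) : V :=
  \sum_(s : I) f s *~ c s.

Fact linext_is_additive (I : finType) (V : zmodType) (f : I -> V) :
  zmod_morphism (linext f).
Proof.
move=> c d; rewrite /linext -sumrB; apply: eq_bigr => s _.
by rewrite !ffunE mulrzBr.
Qed.

HB.instance Definition _ (I : finType) (V : zmodType) (f : I -> V) :=
  GRing.isZmodMorphism.Build {ffun I -> int} V (linext f)
    (linext_is_additive f).

Definition bd_simplex (s : {set 'I_n.+1}) : chain :=
  if (1 < #|s|)%N then \sum_(v in s) cell (s :\ v) *~ (-1) ^+ card_lt s v
  else 0.

Definition bd : {additive chain -> chain} :=
  linext (fun s : simplex => bd_simplex (val s)).

Definition bd2 : {additive chain2 -> chain2} :=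
  linext (fun p : simplex * simplex =>
    tensor (bd_simplex (val p.1)) (cell (val p.2))
    + tensor (cell (val p.1)) (bd_simplex (val p.2))
        *~ (-1) ^+ sdim (val p.1)).

Definition swap : {additive chain2 -> chain2} :=
  linext (fun p : simplex * simplex =>
    tensor (cell (val p.2)) (cell (val p.1))
      *~ (-1) ^+ (sdim (val p.1) * sdim (val p.2))).

(* B(S, i+1) is [consistent i.+1]. The facets of M are ordered by
   M :\ x < M :\ y iff y < x. *)
Definition beginning_segment (U : {set {set 'I_n.+1}}) (M : {set 'I_n.+1}) : Prop :=
  forall x y, x \in M -> y \in M -> (x < y)%N -> M :\ x \in U -> M :\ y \in U.

Definition ending_segment (U : {set {set 'I_n.+1}}) (M : {set 'I_n.+1}) : Prop :=
  forall x y, x \in M -> y \in M -> (x < y)%N -> M :\ y \in U -> M :\ x \in U.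

Definition consistent (j : nat) (U : {set {set 'I_n.+1}}) : Prop :=
  U \subset simplices S j /\
  forall M, M \in simplices S j.+1 ->
    beginning_segment U M \/ ending_segment U M.

Definition cupA (U : {set {set 'I_n.+1}}) (s L : {set 'I_n.+1}) : {set 'I_n.+1} :=
  [set a in s :\: L | if a |: L \in U then ~~ odd (card_gt L a)
                      else odd (card_gt L a)].

Definition cupB (U : {set {set 'I_n.+1}}) (s L : {set 'I_n.+1}) : {set 'I_n.+1} :=
  s :\: (L :|: cupA U s L).

Definition cup_sign (s L A B : {set 'I_n.+1}) : nat :=
  (\sum_(b in B) card_lt A b + \sum_(l in L) card_lt L l + #|s| * #|A|)%N.

Definition cup_simplex (i : nat) (U : {set {set 'I_n.+1}}) (s : {set 'I_n.+1}) :
    chain2 :=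
  \sum_(L : {set 'I_n.+1} | (L \subset s) && (#|L| == i.+1))
    tensor (cell (L :|: cupA U s L)) (cell (L :|: cupB U s L))
      *~ (-1) ^+ cup_sign s L (cupA U s L) (cupB U s L).

Definition cup (i : nat) (U : {set {set 'I_n.+1}}) : {additive chain -> chain2} :=
  linext (fun s : simplex => cup_simplex i U (val s)).

(* Delta_{i-1}^{set0}, which is 0 by convention when i = 0. *)
Definition cup_prev (i : nat) (c : chain) : chain2 :=
  if i is j.+1 then cup j set0 c else 0.

Definition homotopy_formula (i : nat) (D : chain -> chain2) : Prop :=
  forall c : chain,
    bd2 (D c) - D (bd c) *~ (-1) ^+ i
      = cup_prev i c + swap (cup_prev i c) *~ (-1) ^+ i.

Definition has_degree (i : nat) (D : chain -> chain2) : Prop :=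
  forall (s : simplex) (p : simplex * simplex), D (cell (val s)) p != 0 ->
    (sdim (val p.1) + sdim (val p.2) = sdim (val s) + i)%N.

Definition nterms (x : chain2) : nat := #|[set p | x p != 0]|.

Definition admissible (i : nat) (D : {additive chain -> chain2}) : Prop :=
  [/\ has_degree i D,
      homotopy_formula i D
    & i = 0%N -> forall s, s \in simplices S 0 ->
        D (cell s) = tensor (cell s) (cell s)].

Definition pointwise_minimal (i : nat) (D : {additive chain -> chain2}) : Prop :=
  forall D' : {additive chain -> chain2}, admissible i D' ->
  forall s, s \in S -> (nterms (D (cell s)) <= nterms (D' (cell s)))%N.

(* On a given s, pointwise minimality competes with coproducts that have been
   made arbitrarily long on the faces of s. Adding bd2 \o h +/- h \o bd to a
   coproduct, h of degree i+1, preserves [homotopy_formula] and can annihilate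
   its value on s, so no admissible D is pointwise minimal as soon as S has a
   simplex of dimension >= i (if i > 0) or >= 2 (if i = 0). In
   [minimal_terms] the number of terms on s can only be reduced at the cost of
   increasing it on some proper face of s. This asks less of D. *)
Definition minimal_terms (i : nat) (D : {additive chain -> chain2}) : Prop :=
  forall D' : {additive chain -> chain2}, admissible i D' ->
  forall s, s \in S ->
    (forall t, t \in S -> t \proper s ->
       (nterms (D' (cell t)) <= nterms (D (cell t)))%N) ->
    (nterms (D (cell s)) <= nterms (D' (cell s)))%N.

Lemma pointwise_minimal_minimal_terms (i : nat) (D : {additive chain -> chain2}) :
  pointwise_minimal i D -> minimal_terms i D.
Proof. by move=> minD D' admD' s sS _; apply: minD. Qed.

End Chains.

Arguments cell {n} S A.
Arguments cup {n} S i U.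

(* Main.v *)
Require Import Defs.
From HB Require Import structures.
From mathcomp Require Import all_boot all_order all_algebra zify.

Set Implicit Arguments.
Unset Strict Implicit.
Unset Printing Implicit Defensive.

Import GRing.Theory.
Local Open Scope ring_scope.

(* The terms X (x) Y with X :&: Y = L and X :|: Y = s are the vertices of the cube
   of subsets of s :\: L, and the terms of cup_i at s are edges of the cubes of
   the L of cardinal i: one edge in each direction x for each L. The boundary of a
   term is made of the ends of its edges, which lie in the same union s, and of
   terms of union s :\ v. The latter add up to cup_i of the boundary of s,
   whatever U is; for consistent U the edges in the cube of L form a monotone path
   from the empty set to s :\: L, so that the former telescope to
   (1 + (-1)^i T) cup_{i-1}.

   Conversely, cup_i^U always has 'C(#|s|, i+1) terms on s, so a minimal D has at
   most that many once it is known on the faces of s. For each L of cardinal i+1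
   and each v in s :\: L, the signed number of terms of intersection L whose
   union contains s :\ v is read off the boundary of D s and is +1 or -1. Hence D s
   has exactly one term for each L; the boundary determines it when #|s| > i+2,
   leaves two possibilities (in U or not in U) when #|s| = i+2, and forces U to
   be consistent when #|s| = i+3. *)

(** * Signs *)

(** A basis element X (x) Y is determined by its union, its intersection L and A = X minus Y, and
    every argument is carried out in these coordinates. An unknown D is a bare linear map: its value
    on s could involve simplices outside s and terms of any shape. Hence terms are counted with
    linear functionals on all of C(S) (x) C(S), chosen so that both ends of an edge have the same
    weight.

    Minimality is used by comparing D with cup_i of the empty set. By induction on #|s| both have
    the same number of terms on each proper face of s, which makes the comparison legitimate on s.

    For #|s| = i+1 no facet of s contains an L of cardinal i+1, so the boundary is read one step
    lower, at the K of cardinal i. For i = 0 such a K is empty and nothing is left to read, which is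
    why the values on points are prescribed. *)

Section Counting.

Variable n : nat.
Implicit Types (A B s L : {set 'I_n.+1}) (x y : 'I_n.+1).

Definition inversions A B : nat := \sum_(b in B) card_lt A b.

Lemma card_ltE A x : card_lt A x = (\sum_(a in A) (a < x)%N)%N.
Proof.
rewrite /card_lt -sum1_card big_mkcond [RHS]big_mkcond; apply: eq_bigr => a _.
by rewrite inE; case: (a \in A); case: ltnP.
Qed.

Lemma card_gtE A x : card_gt A x = (\sum_(a in A) (x < a)%N)%N.
Proof.
rewrite /card_gt -sum1_card big_mkcond [RHS]big_mkcond; apply: eq_bigr => a _.
by rewrite inE; case: (a \in A); case: ltnP.
Qed.

Lemma card_ltD1 A x y : x \in A -> card_lt A y = ((x < y) + card_lt (A :\ x) y)%N.
Proof. by move=> xA; rewrite !card_ltE (big_setD1 x). Qed.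

Lemma card_ltU1 A x y : x \notin A -> card_lt (x |: A) y = ((x < y) + card_lt A y)%N.
Proof. by move=> xA; rewrite !card_ltE big_setU1. Qed.

Lemma card_gtU1 A x y : x \notin A -> card_gt (x |: A) y = ((y < x) + card_gt A y)%N.
Proof. by move=> xA; rewrite !card_gtE big_setU1. Qed.

Lemma card_ltU A B x : [disjoint A & B] -> card_lt (A :|: B) x = (card_lt A x + card_lt B x)%N.
Proof.
move=> dAB; rewrite !card_ltE -bigU //=.
by apply: eq_bigl => a; rewrite !inE.
Qed.

Lemma card_lt_gt A x : x \notin A -> (card_lt A x + card_gt A x = #|A|)%N.
Proof.
move=> xA; rewrite card_ltE card_gtE -big_split -sum1_card; apply: eq_bigr => a aA /=.
have : (a != x :> nat) by apply: contraNneq xA => /val_inj <-.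
by case: ltngtP.
Qed.

Lemma card_lt_same A x : card_lt (A :\ x) x = card_lt A x.
Proof.
rewrite /card_lt; apply: eq_card => a; rewrite !inE.
by have [->|] := eqVneq a x; rewrite ?ltnn ?andbF.
Qed.

Lemma inversionsD1r A B x : x \in B ->
  inversions A B = (card_lt A x + inversions A (B :\ x))%N.
Proof. by move=> xB; rewrite /inversions (big_setD1 x). Qed.

Lemma inversionsD1l A B x : x \in A ->
  inversions A B = (card_gt B x + inversions (A :\ x) B)%N.
Proof.
move=> xA; rewrite /inversions card_gtE -big_split; apply: eq_bigr => b _.
by rewrite (card_ltD1 _ xA).
Qed.

(** A pair of distinct elements is counted on exactly one side. This compares the sign of a term
    with that of its image under [swap]. *)
Lemma inversions_swap A B : [disjoint A & B] ->
  (inversions A B + inversions B A = #|A| * #|B|)%N.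
Proof.
move=> dAB; rewrite -sum_nat_const /inversions.
under eq_bigr => b _ do rewrite card_ltE.
rewrite exchange_big -big_split; apply: eq_bigr => a aA /=.
rewrite -card_gtE addnC card_lt_gt //.
by rewrite disjoint_sym in dAB; apply: contraL aA => /(disjointFr dAB) ->.
Qed.

Lemma inversions_diag L x : x \in L ->
  inversions L L = (inversions (L :\ x) (L :\ x) + #|L|.-1)%N.
Proof.
move=> xL; rewrite (inversionsD1r _ xL) (inversionsD1l _ xL).
rewrite -card_lt_same addnA card_lt_gt ?setD11 // addnC; congr addn.
by rewrite [in RHS](cardsD1 x) xL.
Qed.

End Counting.

Section SignedSums.

Variable V : zmodType.
Implicit Types x y : V.

Lemma mulrz_sign x m k : x *~ (-1) ^+ m *~ (-1) ^+ k = x *~ (-1) ^+ (m + k).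
Proof. by rewrite -mulrzA exprD. Qed.

Lemma mulrz_signK x m : x *~ (-1) ^+ m *~ (-1) ^+ m = x.
Proof. by rewrite mulrz_sign -signr_odd oddD addbb. Qed.

Lemma eq_mulrz_sign x m k : odd m = odd k -> x *~ (-1) ^+ m = x *~ (-1) ^+ k.
Proof. by move=> e; rewrite -signr_odd e signr_odd. Qed.

Lemma mulrz_signS x m k : odd m = ~~ odd k -> x *~ (-1) ^+ m = - (x *~ (-1) ^+ k).
Proof. by move=> e; rewrite -mulrNz -signr_odd e -[in RHS]signr_odd -signrN. Qed.

End SignedSums.

Lemma sum_setU (I : finType) (V : nmodType) (A B : {set I}) (F : I -> V) :
  [disjoint A & B] ->
  \sum_(i in A :|: B) F i = \sum_(i in A) F i + \sum_(i in B) F i.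
Proof. by move=> dAB; rewrite -bigU //; apply: eq_bigl => i; rewrite !inE. Qed.

(** * Chains and the boundary of a term *)

Section ChainModules.

Variables (n : nat) (S : {set {set 'I_n.+1}}).
Hypothesis HS : simplicial_complex S.
Implicit Types (s L A X Y : {set 'I_n.+1}).

Lemma simplex_neq0 s : s \in S -> s != set0.
Proof. by case: HS => H _; apply: H. Qed.

Lemma set0_notin : set0 \notin S.
Proof. by apply/negP => /simplex_neq0; rewrite eqxx. Qed.

Lemma face_in s X : s \in S -> X \subset s -> X != set0 -> X \in S.
Proof. by case: HS => _ H sS Xs X0; apply: (H s). Qed.

Lemma ffunMzE (I : finType) (W : zmodType) (f : {ffun I -> W}) (z : int) i :
  (f *~ z) i = f i *~ z.
Proof.
have H (m : nat) : (f *+ m) i = f i *+ m by rewrite ffunMnE.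
by case: z => m; rewrite /intmul /= ?ffunE H.
Qed.

Definition mono X Y : chain2 S := tensor (cell S X) (cell S Y).

Lemma monoE X Y p : mono X Y p = ((val p.1 == X) && (val p.2 == Y))%:R.
Proof. by rewrite !ffunE; case: eqP; case: eqP. Qed.

Lemma mono_notinl X Y : X \notin S -> mono X Y = 0.
Proof.
move=> XS; apply/ffunP => p; rewrite monoE !ffunE.
by case: eqP => // E; move: XS; rewrite -E (valP p.1).
Qed.

Lemma mono_notinr X Y : Y \notin S -> mono X Y = 0.
Proof.
move=> XS; apply/ffunP => p; rewrite monoE !ffunE andbC.
by case: eqP => // E; move: XS; rewrite -E (valP p.2).
Qed.

Lemma mono0l Y : mono set0 Y = 0. Proof. exact: mono_notinl set0_notin. Qed.
Lemma mono0r X : mono X set0 = 0. Proof. exact: mono_notinr set0_notin. Qed.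

Lemma linext_delta (I : finType) (W : zmodType) (f : I -> W) (i : I) :
  linext f [ffun j => (j == i)%:R] = f i.
Proof.
rewrite /linext (bigD1 i) //= ffunE eqxx big1 ?addr0 // => j /negPf nji.
by rewrite ffunE nji mulr0z.
Qed.

Lemma linext_cell (W : zmodType) (f : simplex S -> W) (s : simplex S) :
  linext f (cell S (val s)) = f s.
Proof. by rewrite -[RHS]linext_delta; congr linext; apply/ffunP => j; rewrite !ffunE. Qed.

Lemma linext_mono (W : zmodType) (f : simplex S * simplex S -> W) p :
  linext f (mono (val p.1) (val p.2)) = f p.
Proof.
rewrite -[RHS]linext_delta; congr linext; apply/ffunP => j; rewrite monoE ffunE.
by case: p j => [p1 p2] [j1 j2]; rewrite xpair_eqE.
Qed.

Lemma cell_simplex s : s \in S -> exists u : simplex S, val u = s.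
Proof. by move=> sS; exists (exist _ s sS). Qed.

Lemma pair_simplex X Y : X \in S -> Y \in S ->
  exists p : simplex S * simplex S, val p.1 = X /\ val p.2 = Y.
Proof. by move=> XS YS; exists (exist _ X XS, exist _ Y YS). Qed.

Lemma chain_sum (c : chain S) : c = \sum_(s : simplex S) cell S (val s) *~ c s.
Proof.
apply/ffunP => u; rewrite sum_ffunE (bigD1 u) //= ffunMzE ffunE eqxx intz big1 ?addr0 // => j nj.
by rewrite ffunMzE ffunE (inj_eq val_inj) eq_sym (negPf nj) mul0rz.
Qed.

Lemma chain2_sum (c : chain2 S) : c = \sum_p mono (val p.1) (val p.2) *~ c p.
Proof.
apply/ffunP => u; rewrite sum_ffunE (bigD1 u) //= ffunMzE monoE !eqxx intz big1 ?addr0 // => j nj.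
rewrite ffunMzE monoE; case: u j nj => [u1 u2] [j1 j2] /=.
by rewrite xpair_eqE !(inj_eq val_inj) ![_ == u1]eq_sym ![_ == u2]eq_sym => /negPf ->; rewrite mul0rz.
Qed.

(** At a point the sum is [cell set0], which vanishes because the empty set is not in [S]; later
    sums need no case distinction for points. *)
Lemma bd_simplexE s : s \in S ->
  bd_simplex S s = \sum_(v in s) cell S (s :\ v) *~ (-1) ^+ card_lt s v.
Proof.
move=> sS; rewrite /bd_simplex; case: ltnP => // s1; symmetry; apply: big1 => v vs.
have -> : s :\ v = set0.
  by apply/eqP; rewrite -cards_eq0; move: s1; rewrite (cardsD1 v) vs; case: #|_|.
by apply/ffunP => u; rewrite ffunMzE !ffunE (negPf (simplex_neq0 (valP u))) mul0rz.
Qed.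

Lemma tensor_suml (I : finType) (P : pred I) (F : I -> chain S) (z : I -> int) (y : chain S) :
  tensor (\sum_(j | P j) F j *~ z j) y = \sum_(j | P j) tensor (F j) y *~ z j.
Proof.
apply/ffunP => p; rewrite ffunE !sum_ffunE mulr_suml; apply: eq_bigr => j _.
by rewrite !ffunMzE ffunE mulrzAl.
Qed.

Lemma tensor_sumr (I : finType) (P : pred I) (F : I -> chain S) (z : I -> int) (x : chain S) :
  tensor x (\sum_(j | P j) F j *~ z j) = \sum_(j | P j) tensor x (F j) *~ z j.
Proof.
apply/ffunP => p; rewrite ffunE !sum_ffunE mulr_sumr; apply: eq_bigr => j _.
by rewrite !ffunMzE ffunE mulrzAr.
Qed.

Lemma bd_cell s : s \in S -> bd S (cell S s) = bd_simplex S s.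
Proof. move=> /cell_simplex [u <-]; exact: (linext_cell _ u). Qed.

Lemma cup_cell i U s : s \in S -> cup S i U (cell S s) = cup_simplex S i U s.
Proof. move=> /cell_simplex [u <-]; exact: (linext_cell _ u). Qed.

Lemma bd2_mono X Y : X \in S -> Y \in S ->
  bd2 S (mono X Y) = \sum_(v in X) mono (X :\ v) Y *~ (-1) ^+ card_lt X v
    + \sum_(v in Y) mono X (Y :\ v) *~ (-1) ^+ (#|X|.-1 + card_lt Y v).
Proof.
move=> XS YS; have [p [E1 E2]] := pair_simplex XS YS.
have -> : bd2 S (mono X Y) = tensor (bd_simplex S X) (cell S Y)
    + tensor (cell S X) (bd_simplex S Y) *~ (-1) ^+ #|X|.-1.
  by rewrite -E1 -E2; exact: (linext_mono _ p).
rewrite !bd_simplexE // tensor_suml tensor_sumr.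
congr +%R; rewrite mulrz_suml; apply: eq_bigr => v _.
by rewrite mulrz_sign addnC.
Qed.

Lemma swap_mono X Y : X \in S -> Y \in S ->
  swap S (mono X Y) = mono Y X *~ (-1) ^+ (#|X|.-1 * #|Y|.-1).
Proof.
move=> XS YS; have [p [E1 E2]] := pair_simplex XS YS.
rewrite -E1 -E2; exact: (linext_mono _ p).
Qed.

Lemma bd2_mono_sum (W : zmodType) (f : {additive chain2 S -> W}) y :
  f (bd2 S y) = \sum_p f (bd2 S (mono (val p.1) (val p.2))) *~ y p.
Proof.
pose g : {additive chain2 S -> W} := f \o bd2 S.
rewrite -[LHS]/(g y) {1}(chain2_sum y) raddf_sum; apply: eq_bigr => p _.
exact: raddfMz.
Qed.

End ChainModules.

(* The counts are generalized first: lia does not identify them as atoms. *)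
Ltac parity := repeat match goal with
  | H : is_true (0 < _)%N |- _ => move: H
  | H : _ = _ :> nat |- _ => move: H
  end;
  repeat match goal with
  | |- context [inversions ?A ?B] => move: (inversions A B) => ?
  | |- context [card_lt ?A ?x] => move: (card_lt A x) => ?
  | |- context [card_gt ?A ?x] => move: (card_gt A x) => ?
  end;
  repeat match goal with
  | |- context [card ?A] => move: (card A) => ?
  end; lia.

(** * Faces and edges in the boundary of one term *)

Section Terms.

Variables (n : nat) (S : {set {set 'I_n.+1}}).
Hypothesis HS : simplicial_complex S.
Implicit Types (s L A B X Y U : {set 'I_n.+1}).

(** [A] is left free because the ends of an edge, and the terms of an unknown coproduct, need not
    come from [cupA]. [L] may be empty; a term with an empty factor is then 0. *)
Definition term s L A : chain2 S :=
  let B := s :\: (L :|: A) in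
  mono S (L :|: A) (L :|: B) *~ (-1) ^+ cup_sign s L A B.

Lemma cup_simplexE i (U : {set {set 'I_n.+1}}) s : cup_simplex S i U s =
  \sum_(L : {set 'I_n.+1} | (L \subset s) && (#|L| == i.+1)) term s L (cupA U s L).
Proof. by []. Qed.

Lemma cup_signE s L A B :
  cup_sign s L A B = (inversions A B + inversions L L + #|s| * #|A|)%N.
Proof. by []. Qed.

Lemma card_lt_setU3 s L A v : L \subset s -> A \subset s :\: L ->
  card_lt s v = (card_lt L v + card_lt A v + card_lt (s :\: (L :|: A)) v)%N.
Proof.
move=> Ls; rewrite subsetD => /andP[As dAL].
have dB : [disjoint L :|: A & s :\: (L :|: A)].
  by rewrite disjoint_sym disjoints_subset setDE subsetIr.
rewrite disjoint_sym in dAL; rewrite -(card_ltU _ dAL) -(card_ltU _ dB).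
by rewrite -{1}(setID s (L :|: A)) (setIidPr _) // subUset Ls.
Qed.

Lemma cards_setU3 s L A : L \subset s -> A \subset s :\: L ->
  #|s| = (#|L| + #|A| + #|s :\: (L :|: A)|)%N.
Proof.
move=> Ls; rewrite subsetD => /andP[As dAL].
rewrite -(cardsID (L :|: A) s) (setIidPr _) ?subUset ?Ls //.
by rewrite cardsU disjoint_setI0 1?disjoint_sym // cards0 subn0.
Qed.

(** The sign left over does not depend on [A], and [term_faceB] leaves the same one; this is what
    [cup_sign] achieves. *)
Lemma term_faceA s L A a : L \subset s -> A \subset s :\: L -> L != set0 -> a \in A ->
  mono S ((L :|: A) :\ a) (L :|: (s :\: (L :|: A)))
    *~ (-1) ^+ (card_lt (L :|: A) a + cup_sign s L A (s :\: (L :|: A)))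
  = term (s :\ a) L (A :\ a) *~ (-1) ^+ (#|L|.-1 + card_lt s a).
Proof.
move=> Ls AsL L0 aA; have := subsetP AsL a aA; rewrite inE => /andP[aL as_].
have dLA : [disjoint L & A] by move: AsL; rewrite subsetD disjoint_sym => /andP[].
have EB : s :\ a :\: (L :|: A :\ a) = s :\: (L :|: A).
  by apply/setP => z; rewrite !inE; have [->|//] := eqVneq z a; rewrite aA (negPf aL).
have EX : (L :|: A) :\ a = L :|: A :\ a.
  by apply/setP => z; rewrite !inE; have [->|//] := eqVneq z a; rewrite (negPf aL).
rewrite /term EB EX mulrz_sign; apply: eq_mulrz_sign.
rewrite !cup_signE (inversionsD1l _ aA) (card_lt_setU3 _ Ls AsL) card_ltU //.
have aB : a \notin s :\: (L :|: A) by rewrite !inE aA orbT.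
have := card_lt_gt aB; have := cards_setU3 Ls AsL.
have es : #|s| = #|s :\ a|.+1 by rewrite (cardsD1 a s) as_.
have eA : #|A| = #|A :\ a|.+1 by rewrite (cardsD1 a A) aA.
rewrite -card_gt0 in L0; rewrite es eA mulSn mulnS.
by parity.
Qed.

Lemma term_faceB s L A b : L \subset s -> A \subset s :\: L -> L != set0 ->
  b \in s :\: (L :|: A) ->
  mono S (L :|: A) ((L :|: (s :\: (L :|: A))) :\ b)
    *~ (-1) ^+ (#|L :|: A|.-1 + card_lt (L :|: (s :\: (L :|: A))) b
                + cup_sign s L A (s :\: (L :|: A)))
  = term (s :\ b) L (A :\ b) *~ (-1) ^+ (#|L|.-1 + card_lt s b).
Proof.
move=> Ls AsL L0 bB; have := bB; rewrite !inE negb_or => /andP[/andP[bL bA] bs].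
have dLA : [disjoint L & A] by move: AsL; rewrite subsetD disjoint_sym => /andP[].
have dLB : [disjoint L & s :\: (L :|: A)].
  by rewrite disjoint_sym disjoints_subset; apply/subsetP => z; rewrite !inE; case: (z \in L).
have EA : A :\ b = A by apply/setDidPl; rewrite disjoint_sym disjoints1.
have EB : s :\ b :\: (L :|: A) = (s :\: (L :|: A)) :\ b.
  by apply/setP => z; rewrite !inE; case: (z == b); rewrite ?andbF.
have EY : (L :|: s :\: (L :|: A)) :\ b = L :|: (s :\: (L :|: A)) :\ b.
  by apply/setP => z; rewrite !inE; have [->|//] := eqVneq z b; rewrite (negPf bL).
rewrite /term EA EB EY mulrz_sign; apply: eq_mulrz_sign.
rewrite !cup_signE (inversionsD1r _ bB) (card_lt_setU3 _ Ls AsL) card_ltU //.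
rewrite cardsU disjoint_setI0 // cards0 subn0.
have es : #|s| = #|s :\ b|.+1 by rewrite (cardsD1 b s) bs.
rewrite -card_gt0 in L0; rewrite es mulSn.
by parity.
Qed.

(** A vertex of [L] deleted from the left factor survives in the right one, so it joins the [B] side
    of the smaller intersection [L :\ x]. In [term_edger] it joins the [A] side, with the opposite
    sign. *)
Lemma term_edgel s L A x : L \subset s -> A \subset s :\: L -> x \in L ->
  mono S ((L :|: A) :\ x) (L :|: (s :\: (L :|: A)))
    *~ (-1) ^+ (card_lt (L :|: A) x + cup_sign s L A (s :\: (L :|: A)))
  = term s (L :\ x) A *~ (-1) ^+ (#|L|.-1 + card_lt L x).
Proof.
move=> Ls AsL xL; have xs := subsetP Ls x xL.
have dLA : [disjoint L & A] by move: AsL; rewrite subsetD disjoint_sym => /andP[].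
have xA : x \notin A by rewrite (disjointFr dLA).
have EX : (L :|: A) :\ x = L :\ x :|: A.
  by apply/setP => z; rewrite !inE; have [->|//] := eqVneq z x; rewrite (negPf xA).
have EB : (s :\: (L :\ x :|: A)) :\ x = s :\: (L :|: A).
  by apply/setP => z; rewrite !inE; have [->|//] := eqVneq z x; rewrite xL.
have EY : L :|: (s :\: (L :|: A)) = L :\ x :|: (s :\: (L :\ x :|: A)).
  by apply/setP => z; rewrite !inE; have [->|//] := eqVneq z x; rewrite xL xs (negPf xA).
have xB : x \in s :\: (L :\ x :|: A) by rewrite !inE eqxx xs (negPf xA).
rewrite /term EX EY mulrz_sign; apply: eq_mulrz_sign.
rewrite !cup_signE (inversionsD1r _ xB) EB card_ltU // (inversions_diag xL).
by parity.
Qed.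

Lemma term_edger s L A x : L \subset s -> A \subset s :\: L -> x \in L ->
  mono S (L :|: A) ((L :|: (s :\: (L :|: A))) :\ x)
    *~ (-1) ^+ (#|L :|: A|.-1 + card_lt (L :|: (s :\: (L :|: A))) x
                + cup_sign s L A (s :\: (L :|: A)))
  = - (term s (L :\ x) (x |: A) *~ (-1) ^+ (#|L|.-1 + card_lt L x)).
Proof.
move=> Ls AsL xL; have xs := subsetP Ls x xL.
have dLA : [disjoint L & A] by move: AsL; rewrite subsetD disjoint_sym => /andP[].
have xA : x \notin A by rewrite (disjointFr dLA).
have dLB : [disjoint L & s :\: (L :|: A)].
  by rewrite disjoint_sym disjoints_subset; apply/subsetP => z; rewrite !inE; case: (z \in L).
have EX : L :\ x :|: (x |: A) = L :|: A.
  by apply/setP => z; rewrite !inE; have [->|//] := eqVneq z x; rewrite xL.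
have EY : (L :|: s :\: (L :|: A)) :\ x = L :\ x :|: (s :\: (L :|: A)).
  by apply/setP => z; rewrite !inE; have [->|//] := eqVneq z x; rewrite xL.
rewrite /term EX EY mulrz_sign; apply: mulrz_signS.
have EA : (x |: A) :\ x = A by rewrite setU1K.
have xA' : x \in x |: A by rewrite setU11.
rewrite !cup_signE (inversionsD1l _ xA') EA card_ltU // (inversions_diag xL).
rewrite cardsU disjoint_setI0 // cards0 subn0 cardsU1 xA add1n mulnS.
have xB : x \notin s :\: (L :|: A) by rewrite !inE xL.
have := card_lt_gt xB; have := cards_setU3 Ls AsL.
have eL : #|L| = #|L :\ x|.+1 by rewrite (cardsD1 x L) xL.
by parity.
Qed.

Lemma bd2_term s L A : L \subset s -> A \subset s :\: L -> L != set0 ->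
  L :|: A \in S -> L :|: (s :\: (L :|: A)) \in S ->
  bd2 S (term s L A) =
    \sum_(v in s :\: L) term (s :\ v) L (A :\ v) *~ (-1) ^+ (#|L|.-1 + card_lt s v)
    + \sum_(x in L) (term s (L :\ x) A - term s (L :\ x) (x |: A))
        *~ (-1) ^+ (#|L|.-1 + card_lt L x).
Proof.
move=> Ls AsL L0 XS YS.
have dLA : [disjoint L & A] by move: AsL; rewrite subsetD disjoint_sym => /andP[].
have dLB : [disjoint L & s :\: (L :|: A)].
  by rewrite disjoint_sym disjoints_subset; apply/subsetP => z; rewrite !inE; case: (z \in L).
have dAB : [disjoint A & s :\: (L :|: A)].
  rewrite disjoint_sym disjoints_subset; apply/subsetP => z; rewrite !inE.
  by case: (z \in A); rewrite ?orbT.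
have -> : s :\: L = A :|: (s :\: (L :|: A)).
  apply/setP => z; have := subsetP AsL z; rewrite !inE.
  by case: (z \in A); case: (z \in L); case: (z \in s) => // /(_ isT).
rewrite {1}/term raddfMz bd2_mono //= mulrzDl !mulrz_suml !sum_setU //.
rewrite addrACA [LHS]addrC; congr (_ + _).
  congr (_ + _); apply: eq_bigr => v vA; rewrite mulrz_sign.
    exact: term_faceA.
  exact: term_faceB.
rewrite -big_split; apply: eq_bigr => x xL /=.
by rewrite !mulrz_sign term_edgel // term_edger // mulrzBl.
Qed.

End Terms.

(** * Monotone paths and the homotopy formula *)

(** Induction on [W], removing its last element [m]: the summand of [m] is F (W :\ m) - F W, and [m]
    precedes nothing, so the other summands are those of W :\ m. *)
Lemma telescope_order (I : finType) (V : zmodType) (r : rel I) (W : {set I}) (F : {set I} -> V) :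
  {in W, irreflexive r} -> {in W & &, transitive r} ->
  {in W &, forall a b, a != b -> r a b || r b a} ->
  \sum_(x in W) (F [set a in W | r a x] - F (x |: [set a in W | r a x])) = F set0 - F W.
Proof.
have [k] := ubnP #|W|; elim: k W => // k IHk W Wk irr trans tot.
have [->|[w wW]] := set_0Vmem W; first by rewrite big_set0 subrr.
pose below x := [set a in W | r a x].
(* An element with the most predecessors is last: anything after it would, by transitivity, have
   strictly more. *)
have [m mW maxm] := arg_maxnP (fun x => #|below x|) wW.
have {}mW : m \in W by [].
have ltm a : a \in W -> a != m -> r a m.
  move=> aW am; have /orP[//|rma] := tot _ _ aW mW am.
  have := maxm a aW; rewrite /= leqNgt (@proper_card _ (below m)) //; apply/properP; split.
    apply/subsetP => b; rewrite !inE => /andP[bW rbm].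
    by rewrite bW (trans _ _ _ mW bW aW).
  by exists m; rewrite !inE ?mW ?irr.
have mlt a : a \in W -> r m a = false.
  move=> aW; have [->|am] := eqVneq a m; first exact: irr.
  apply/negP => rma; have := trans _ _ _ aW mW mW rma (ltm _ aW am).
  by rewrite irr.
have Em : below m = W :\ m.
  apply/setP => a; rewrite !inE; have [->|am] := eqVneq a m; first by rewrite irr // andbF.
  by have [aW|//] := boolP (a \in W); rewrite ltm.
rewrite (big_setD1 m mW) /= -/(below m) Em setD1K //.
have E x : x \in W :\ m -> [set a in W | r a x] = [set a in W :\ m | r a x].
  rewrite inE => /andP[xm xW]; apply/setP => a; rewrite !inE.
  by have [->|] := eqVneq a m; rewrite ?mlt ?andbF.
under eq_bigr => x xW do rewrite E //.
have sub a : a \in W :\ m -> a \in W by rewrite inE => /andP[].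
rewrite IHk.
- by rewrite addrC subrKA.
- by move: Wk; rewrite (cardsD1 m) mW.
- by move=> a /sub; apply: irr.
- by move=> a b c /sub aW /sub bW /sub cW; apply: trans.
- by move=> a b /sub aW /sub bW; apply: tot.
Qed.

(** * Boundaries of sums of terms, in cube coordinates *)

Section Boundary.

Variables (n : nat) (S : {set {set 'I_n.+1}}).
Hypothesis HS : simplicial_complex S.
Implicit Types (s L A P Q U M : {set 'I_n.+1}).

(* Terms whose factors intersect in L and have union s are the vertices of the
   cube of subsets of s :\: L. In these coordinates the two extreme vertices
   are, up to sign, the terms of (1 +/- T) cup_{|L|-1} set0, and the boundary of
   an edge is start minus end with no extra sign. *)
Definition twist s L P : {set 'I_n.+1} :=
  [set a in s :\: L | (a \in P) (+) odd (card_gt L a)].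

Definition vertex s L P : chain2 S := term S s L (twist s L P).

(** The end without [x] of the edge [term s (x |: L) A], in the twisted coordinates of the cube of
    [L]. *)
Definition edge_start s L x A : {set 'I_n.+1} :=
  [set a in s :\: (x |: L) | (a \in A) (+) odd (card_gt L a)].

Lemma twist_sub s L P : twist s L P \subset s :\: L.
Proof. by apply/subsetP => a; rewrite inE => /andP[]. Qed.

Lemma twist_inj s L P Q : P \subset s :\: L -> Q \subset s :\: L ->
  twist s L P = twist s L Q -> P = Q.
Proof.
move=> Ps Qs /setP E; apply/setP => a; have := E a; rewrite !inE -in_setD.
have := subsetP Ps a; have := subsetP Qs a; rewrite !inE.
case: (a \in P); case: (a \in Q); case: (_ && _) => //= H1 H2.
all: do ?[by case: odd | by have := H1 isT | by have := H2 isT].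
Qed.

(** Twisting exchanges the two ends of the edge exactly when [card_gt L x] is odd, and #|L| +
    card_lt L x has the same parity; the sign is absorbed. *)
Lemma edge_startP s L x A : x \in s -> x \notin L -> A \subset s :\: (x |: L) ->
  (term S s L A - term S s L (x |: A)) *~ (-1) ^+ (#|L| + card_lt L x)
  = vertex s L (edge_start s L x A) - vertex s L (x |: edge_start s L x A).
Proof.
move=> xs xL As; rewrite /vertex.
have xA : x \notin A by apply/negP => /(subsetP As); rewrite !inE eqxx.
have E1 b : b = odd (card_gt L x) ->
    twist s L (if b then x |: edge_start s L x A else edge_start s L x A) = A.
  move=> Eb; apply/setP => a; have := subsetP As a; rewrite !inE.
  have [->|ax] := eqVneq a x.
    by move=> _; rewrite xs xL (negPf xA) -Eb; case: b Eb => _; rewrite !inE eqxx.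
  case: b Eb => _; rewrite !inE (negPf ax) /=.
    by case: (a \in A) => [/(_ isT)|_]; case: (a \in L); case: (a \in s); case: odd.
  by case: (a \in A) => [/(_ isT)|_]; case: (a \in L); case: (a \in s); case: odd.
have E2 b : b = odd (card_gt L x) ->
    twist s L (if b then edge_start s L x A else x |: edge_start s L x A) = x |: A.
  move=> Eb; apply/setP => a; have := subsetP As a; rewrite !inE.
  have [->|ax] := eqVneq a x.
    by move=> _; rewrite xs xL -Eb; case: b Eb => _; rewrite !inE eqxx.
  case: b Eb => _; rewrite !inE (negPf ax) /=.
    by case: (a \in A) => [/(_ isT)|_]; case: (a \in L); case: (a \in s); case: odd.
  by case: (a \in A) => [/(_ isT)|_]; case: (a \in L); case: (a \in s); case: odd.
rewrite (@eq_mulrz_sign _ _ _ (odd (card_gt L x))).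
  have := E1 _ erefl; have := E2 _ erefl.
  by case: odd => -> ->; rewrite ?expr1 ?mulrNz ?mulr1z ?opprB.
by rewrite oddb -(card_lt_gt xL) !oddD; case: odd; case: odd.
Qed.

(** The choice [A] and the coefficients [c] are arbitrary, so that this serves both for [cup] and
    for a coproduct whose terms are still to be determined. *)
Lemma bd2_sum_term i s (A : {set 'I_n.+1} -> {set 'I_n.+1}) (c : {set 'I_n.+1} -> int) :
  s \in S ->
  (forall L, L \subset s -> #|L| = i.+1 -> A L \subset s :\: L) ->
  bd2 S (\sum_(L : {set 'I_n.+1} | (L \subset s) && (#|L| == i.+1)) term S s L (A L) *~ c L)
  = \sum_(v in s) (\sum_(L : {set 'I_n.+1} | (L \subset s :\ v) && (#|L| == i.+1))
       term S (s :\ v) L (A L :\ v) *~ c L) *~ (-1) ^+ (i + card_lt s v)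
  + \sum_(L : {set 'I_n.+1} | (L \subset s) && (#|L| == i)) \sum_(x in s :\: L)
      (vertex s L (edge_start s L x (A (x |: L)))
       - vertex s L (x |: edge_start s L x (A (x |: L)))) *~ c (x |: L).
Proof.
move=> sS Asub; rewrite raddf_sum /=.
transitivity (\sum_(L : {set 'I_n.+1} | (L \subset s) && (#|L| == i.+1))
   (\sum_(v in s :\: L) term S (s :\ v) L (A L :\ v) *~ c L *~ (-1) ^+ (i + card_lt s v)
   + \sum_(x in L) (term S s (L :\ x) (A L) - term S s (L :\ x) (x |: A L))
        *~ (-1) ^+ (i + card_lt L x) *~ c L)).
  apply: eq_bigr => L /andP[Ls /eqP Li].
  have L0 : L != set0 by rewrite -card_gt0 Li.
  have ne X : L :|: X != set0.
    by apply: contraNneq L0 => E; rewrite -subset0 -E subsetUl.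
  have As := Asub _ Ls Li.
  rewrite raddfMz bd2_term // ?Li /=.
  - rewrite mulrzDl !mulrz_suml; congr (_ + _).
    by apply: eq_bigr => v _; rewrite -[LHS]mulrzA -[RHS]mulrzA [in RHS]mulrC.
  - apply: (face_in HS sS) => //; rewrite subUset Ls.
    by apply: subset_trans As _; rewrite subsetDl.
  - by apply: (face_in HS sS) => //; rewrite subUset Ls subsetDl.
rewrite big_split /=; congr (_ + _).
  rewrite (exchange_big_dep [in s]) /=; last by move=> L v _; rewrite inE => /andP[].
  apply: eq_bigr => v vs; rewrite mulrz_suml; apply: eq_bigl => L.
  by rewrite subsetD1 inE vs andbT; case: (v \in L); rewrite ?andbF ?andbT.
rewrite (exchange_big_dep [in s]) /=; last by move=> L x /andP[/subsetP Ls _] /Ls.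
rewrite [RHS](exchange_big_dep [in s]) /=; last by move=> L v _; rewrite inE => /andP[].
apply: eq_bigr => x xs.
(* A set of cardinal i+1 with a chosen element [x] is an edge in direction [x] of the cube of a set
   of cardinal i. *)
rewrite (reindex_onto (fun L => x |: L) (fun L => L :\ x)) /=; last first.
  by move=> L /andP[_ xL]; rewrite setD1K.
apply: eq_big => [L|L].
  rewrite subUset sub1set xs /= setU11 andbT inE xs andbT cardsU1 eqEsubset.
  have [xL|xL] := boolP (x \in L).
    rewrite !andbF; apply/negP => /andP[_ /andP[_ /subsetP/(_ x xL)]].
    by rewrite !inE eqxx.
  by rewrite setU1K // subxx !andbT add1n eqSS.
move=> /andP[/andP[/andP[Ls Li] _] /eqP EL].
have xL : x \notin L by rewrite -EL !inE eqxx.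
have cL : #|L| = i by apply/eqP; move: Li; rewrite cardsU1 xL add1n eqSS.
have E := edge_startP xs xL (Asub _ Ls (eqP Li)); rewrite cL in E.
rewrite (setU1K xL) (card_ltU1 _ xL) ltnn add0n.
exact: (congr1 (fun y => y *~ c (x |: L)) E).
Qed.

End Boundary.

(** * Consistency as transitivity, and the homotopy formula *)

Section Homotopy.

Variables (n : nat) (S : {set {set 'I_n.+1}}).
Hypothesis HS : simplicial_complex S.
Implicit Types (s L A P Q U M : {set 'I_n.+1}) (V : {set {set 'I_n.+1}}).

Lemma term_comps s L A : s \in S -> L \subset s -> A \subset s :\: L -> L != set0 ->
  L :|: A \in S /\ L :|: (s :\: (L :|: A)) \in S.
Proof.
move=> sS Ls As L0.
have ne X : L :|: X != set0 by apply: contraNneq L0 => E; rewrite -subset0 -E subsetUl.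
split; apply: (face_in HS sS) => //; rewrite subUset Ls ?subsetDl //.
by apply: subset_trans As _; rewrite subsetDl.
Qed.

Lemma swap_term s L A : s \in S -> L \subset s -> A \subset s :\: L -> L != set0 ->
  swap S (term S s L A) *~ (-1) ^+ #|L| = - term S s L (s :\: (L :|: A)).
Proof.
move=> sS Ls As L0; have [XS YS] := term_comps sS Ls As L0.
have EA : s :\: (L :|: s :\: (L :|: A)) = A.
  apply/setP => z; have := subsetP As z; have := subsetP Ls z; rewrite !inE.
  case: (z \in A); case: (z \in L); case: (z \in s) => //= H1 H2;
    first [by have := H1 isT | by have := H2 isT].
have dLA : [disjoint L & A] by move: As; rewrite subsetD disjoint_sym => /andP[].
have dLB : [disjoint L & s :\: (L :|: A)].
  by rewrite disjoint_sym disjoints_subset; apply/subsetP => z; rewrite !inE; case: (z \in L).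
have dAB : [disjoint A & s :\: (L :|: A)].
  rewrite disjoint_sym disjoints_subset; apply/subsetP => z; rewrite !inE.
  by case: (z \in A); rewrite ?orbT.
rewrite /term EA raddfMz swap_mono // !mulrz_sign; apply: mulrz_signS.
rewrite !cup_signE !cardsU !disjoint_setI0 // !cards0 !subn0.
have := inversions_swap dAB; rewrite (cards_setU3 Ls As); rewrite -card_gt0 in L0.
set B := s :\: (L :|: A).
move: (inversions A B) (inversions B A) (inversions L L) #|A| #|B| #|L| L0.
move=> a b c p q [//|l] _ E /=; rewrite !addSn /=.
have : odd (a + b) = odd (p * q) by rewrite E.
rewrite !(oddD, oddM, oddS); move: (odd a) (odd b) (odd c) (odd l) (odd p) (odd q).
by do 6!case.
Qed.

Lemma twist0 s L : twist s L set0 = cupA set0 s L.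
Proof. by apply/setP => a; rewrite !inE. Qed.

Lemma twist_full s L : twist s L (s :\: L) = s :\: (L :|: twist s L set0).
Proof.
apply/setP => a; rewrite !inE.
by case: (a \in L); case: (a \in s); case: odd.
Qed.

(** [swap] exchanges the two extreme vertices of each cube. For i = 0 the only [L] is empty, and
    both extreme vertices have an empty factor, hence vanish. *)
Lemma cup_prev_cell i s : s \in S ->
  cup_prev i (cell S s) + swap S (cup_prev i (cell S s)) *~ (-1) ^+ i
  = \sum_(L : {set 'I_n.+1} | (L \subset s) && (#|L| == i))
      (vertex S s L set0 - vertex S s L (s :\: L)).
Proof.
move=> sS; case: i => [|i] /=.
  rewrite raddf0 add0r mul0rz big1 // => L /andP[_]; rewrite cards_eq0 => /eqP ->.
  have E P : P \subset s -> twist s set0 P = P.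
    move=> Ps; apply/setP => a; rewrite !inE (_ : card_gt _ _ = 0%N).
      by have := subsetP Ps a; case: (a \in P) => [->|]; rewrite ?andbF.
    by apply/eqP; rewrite cards_eq0; apply/eqP/setP => b; rewrite !inE.
  rewrite /vertex /term setD0 !E ?sub0set // !set0U setDv.
  by rewrite (mono0l HS) (mono0r HS) !mul0rz subrr.
rewrite cup_cell // cup_simplexE raddf_sum mulrz_suml -big_split /=.
apply: eq_bigr => L /andP[Ls /eqP Li].
have L0 : L != set0 by rewrite -card_gt0 Li.
have := swap_term sS Ls (twist_sub s L set0) L0; rewrite Li => H.
by rewrite /vertex -twist0 H -twist_full.
Qed.

(* The edge in direction x of the cube of L starts at the set of the vertices
   preceding x. On three vertices, a cyclic triple for this comparison is a
   sequence of facets alternating in and out of V, so consistency of V amounts to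
   transitivity, and the edges form a monotone path through the cube. *)
Definition precedes V L : rel 'I_n.+1 :=
  fun a x => (a != x) && ((a < x)%N (+) (a |: (x |: L) \in V)).

(** [card_gt (x |: L) a] exceeds [card_gt L a] by one exactly when a < x, so the two parities leave
    the comparison of [a] with [x], reversed if [a |: (x |: L)] is in [V]. *)
Lemma edge_start_cup V s L x : x \notin L ->
  edge_start s L x (cupA V s (x |: L)) = [set a in s :\: L | precedes V L a x].
Proof.
move=> xL; apply/setP => a; rewrite !inE /precedes card_gtU1 // oddD oddb.
by case: (a == x); case: (a \in L); case: (a \in s); case: (_ \in V); case: odd; case: (a < x)%N.
Qed.

(** A segment at either end is a set whose membership changes at most once along the facets, and two
    changes already show on three facets. *)
Lemma segmentP V M : (beginning_segment V M \/ ending_segment V M) <->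
  (forall x y z, x \in M -> y \in M -> z \in M -> (x < y < z)%N ->
     ~~ ((M :\ x \in V) (+) (M :\ y \in V)) || ~~ ((M :\ y \in V) (+) (M :\ z \in V))).
Proof.
split=> [H x y z xM yM zM /andP[xy yz]|H].
  case: H => H.
    have := H x y xM yM xy; have := H y z yM zM yz.
    case: (M :\ x \in V); case: (M :\ y \in V); case: (M :\ z \in V) => // H1 H2;
    first [by have := H1 isT | by have := H2 isT].
  have := H x y xM yM xy; have := H y z yM zM yz.
  case: (M :\ x \in V); case: (M :\ y \in V); case: (M :\ z \in V) => // H1 H2;
    first [by have := H1 isT | by have := H2 isT].
have [/existsP[x /existsP[y /and5P[xM yM xy xV yV]]]|noB] := boolP [exists x, exists y,
    [&& x \in M, y \in M, (x < y)%N, M :\ x \in V & M :\ y \notin V]].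
  right=> x' y' xM' yM' xy' yV'; apply: contraT => xV'.
  have [yy|yy|/val_inj yy] := ltngtP y y'.
  - have := H x y y' xM yM yM'; rewrite xy yy => /(_ isT).
    by rewrite xV (negPf yV) yV'.
  - have := H x' y' y xM' yM' yM; rewrite xy' yy => /(_ isT).
    by rewrite (negPf xV') (negPf yV) yV'.
  by rewrite yy yV' in yV.
left=> x y xM yM xy xV; apply: contraT => yV; case/negP: noB.
by apply/existsP; exists x; apply/existsP; exists y; rewrite xM yM xy xV yV.
Qed.

Lemma precedes_trans j V s L : consistent S j.+1 V -> s \in S -> L \subset s ->
  #|L| = j -> {in s :\: L & &, transitive (precedes V L)}.
Proof.
move=> [_ cons] sS Ls Lj.
have key x y z : x \in s :\: L -> y \in s :\: L -> z \in s :\: L -> (x < y < z)%N ->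
    ~~ ((y |: (z |: L) \in V) (+) (x |: (z |: L) \in V))
    || ~~ ((x |: (z |: L) \in V) (+) (x |: (y |: L) \in V)).
  rewrite !inE => /andP[xL xs] /andP[yL ys] /andP[zL zs] /andP[xy yz].
  have nxy : x != y by apply: contraTneq xy => ->; rewrite ltnn.
  have nyz : y != z by apply: contraTneq yz => ->; rewrite ltnn.
  have nxz : x != z by apply: contraTneq (ltn_trans xy yz) => ->; rewrite ltnn.
  pose M := x |: (y |: (z |: L)).
  have cM : #|M| = j.+3.
    by rewrite !cardsU1 !inE !negb_or nxy nyz nxz xL yL zL Lj.
  have MS : M \in simplices S j.+2.
    rewrite inE cM eqxx andbT; apply: (face_in HS sS); last by rewrite -card_gt0 cM.
    by rewrite !subUset !sub1set xs ys zs.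
  have /segmentP/(_ x y z) := cons _ MS.
  have -> : M :\ x = y |: (z |: L) by rewrite setU1K // !inE !negb_or nxy nxz.
  have -> : M :\ y = x |: (z |: L).
    by rewrite /M setUCA setU1K // !inE !negb_or eq_sym nxy nyz.
  have -> : M :\ z = x |: (y |: L).
    rewrite /M (setUCA [set y]) (setUCA [set x]) setU1K // !inE !negb_or.
    by rewrite eq_sym nxz eq_sym nyz.
  by apply; rewrite ?inE ?eqxx ?orbT // xy yz.
move=> b a c bW aW cW; rewrite /precedes.
case: eqVneq => // nab; case: eqVneq => // nbc /=.
have [->|nac] := eqVneq a c.
  have : (c != b :> nat) by apply: contraNneq nbc => /val_inj ->.
  by rewrite (setUCA [set c]); case: ltngtP => //= _ _; case: (_ \in V).
(* The order of [a], [b], [c] is unknown: all six instances are kept, and only the increasing one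
   has its premise satisfied. *)
have := key a b c aW bW cW; have := key a c b aW cW bW; have := key b a c bW aW cW.
have := key b c a bW cW aW; have := key c a b cW aW bW; have := key c b a cW bW aW.
have C x y : y |: (x |: L) = x |: (y |: L) by rewrite setUCA.
rewrite (C a b) (C b c) (C a c).
have : (a != c :> nat) by apply: contraNneq nac => /val_inj ->.
have : (b != c :> nat) by apply: contraNneq nbc => /val_inj ->.
have : (a != b :> nat) by apply: contraNneq nab => /val_inj ->.
case: (ltngtP a b) => // ab _; case: (ltngtP b c) => // bc _; case: (ltngtP a c) => // ac _ /=.
all: try by exfalso; move: ab bc ac; clear; lia.
all: case: (_ |: (_ |: L) \in V); case: (_ |: (_ |: L) \in V); case: (_ |: (_ |: L) \in V) => //=.
all: by do ?[move=> /(_ isT) // | move=> _].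
Qed.

Lemma precedes_irr V L x : precedes V L x x = false.
Proof. by rewrite /precedes eqxx. Qed.

Lemma precedes_total V L a b : a != b -> precedes V L a b || precedes V L b a.
Proof.
move=> nab; rewrite /precedes nab eq_sym nab (setUCA [set a]) /=.
have : (a != b :> nat) by apply: contraNneq nab => /val_inj ->.
by case: ltngtP => // _ _; case: (_ \in V).
Qed.

(** Stated for plain functions because the two sides of the homotopy formula are not bundled
    additive maps. *)
Lemma additive_cell_ext (f g : chain S -> chain2 S) :
  zmod_morphism f -> zmod_morphism g ->
  (forall s, s \in S -> f (cell S s) = g (cell S s)) -> f =1 g.
Proof.
move=> fB gB E c.
pose fa : {additive chain S -> chain2 S} :=
  HB.pack f (GRing.isZmodMorphism.Build _ _ f fB).
pose ga : {additive chain S -> chain2 S} :=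
  HB.pack g (GRing.isZmodMorphism.Build _ _ g gB).
rewrite -[f c]/(fa c) -[g c]/(ga c) (chain_sum c) !raddf_sum.
by apply: eq_bigr => u _; rewrite !raddfMz /= E ?(valP u).
Qed.

Lemma homotopy_formula_cell i (D : {additive chain S -> chain2 S}) :
  (forall s, s \in S -> bd2 S (D (cell S s)) =
     D (bd_simplex S s) *~ (-1) ^+ i
     + \sum_(L : {set 'I_n.+1} | (L \subset s) && (#|L| == i))
         (vertex S s L set0 - vertex S s L (s :\: L))) <->
  homotopy_formula i D.
Proof.
split=> [H|H s sS]; last first.
  by have := H (cell S s); rewrite cup_prev_cell // bd_cell // => <-; rewrite addrC subrK.
apply: additive_cell_ext => [c d|c d|s sS].
- by rewrite (raddfB (bd S)) !(raddfB D) (raddfB (bd2 S)) mulrzBl !opprB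
    addrACA [RHS]addrACA [X in _ = _ + X]addrC.
- case: i H => [|i] _ /=; first by rewrite !raddf0 !mul0rz !addr0 subr0.
  by rewrite (raddfB (cup S i set0)) (raddfB (swap S)) mulrzBl opprD addrACA.
by rewrite cup_prev_cell // bd_cell // H // addrC addrA addNr add0r.
Qed.

Lemma cell0 : cell S set0 = 0.
Proof. by apply/ffunP => u; rewrite !ffunE (negPf (simplex_neq0 HS (valP u))). Qed.

Lemma cup_simplex0 i V : cup_simplex S i V set0 = 0.
Proof.
rewrite cup_simplexE big1 // => L /andP[].
by rewrite subset0 => /eqP ->; rewrite cards0.
Qed.

Lemma additive_bd (f : {additive chain S -> chain2 S}) i V s : s \in S ->
  (forall t, t \in S -> t \proper s -> f (cell S t) = cup_simplex S i V t) ->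
  f (bd_simplex S s) = \sum_(v in s) cup_simplex S i V (s :\ v) *~ (-1) ^+ card_lt s v.
Proof.
move=> sS fE; rewrite bd_simplexE // raddf_sum; apply: eq_bigr => v vs; rewrite raddfMz.
have [->|v0] := eqVneq (s :\ v) set0; first by rewrite cell0 raddf0 cup_simplex0.
by rewrite fE ?properD1 // (face_in HS sS) // subsetDl.
Qed.

Lemma cupA_sub V s L : cupA V s L \subset s :\: L.
Proof. by apply/subsetP => a; rewrite inE => /andP[]. Qed.

(** Whether a vertex of [s] outside [L] lies in [A] depends on that vertex, [L] and [V], not on the
    rest of [s]; so the terms of union [s :\ v] reassemble into the cup value on that facet. *)
Lemma cupAD1 V s L v : cupA V s L :\ v = cupA V (s :\ v) L.
Proof.
by apply/setP => a; rewrite !inE; case: (a == v); rewrite ?andbF ?andbT.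
Qed.

Lemma homotopy_cup i V : consistent S i.+1 V -> homotopy_formula i (cup S i V).
Proof.
move=> consV; apply/homotopy_formula_cell => s sS.
rewrite (additive_bd (i := i) (V := V) sS) => [|t tS _]; last exact: cup_cell.
rewrite cup_cell // cup_simplexE.
have -> : \sum_(L : {set 'I_n.+1} | (L \subset s) && (#|L| == i.+1)) term S s L (cupA V s L)
    = \sum_(L : {set 'I_n.+1} | (L \subset s) && (#|L| == i.+1)) term S s L (cupA V s L) *~ 1.
  by apply: eq_bigr => L _; rewrite mulr1z.
rewrite (bd2_sum_term HS (fun=> 1)) //; last by move=> *; apply: cupA_sub.
congr (_ + _).
  rewrite mulrz_suml; apply: eq_bigr => v vs.
  rewrite [RHS]mulrz_sign.
  have -> : \sum_(L : {set 'I_n.+1} | (L \subset s :\ v) && (#|L| == i.+1))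
      term S (s :\ v) L (cupA V s L :\ v) *~ 1 = cup_simplex S i V (s :\ v).
    by rewrite cup_simplexE; apply: eq_bigr => L _; rewrite mulr1z cupAD1.
  by rewrite addnC.
apply: eq_bigr => L /andP[Ls /eqP Li].
apply: (etrans _ (@telescope_order _ _ (precedes V L) (s :\: L) (vertex S s L)
  (in1W (precedes_irr V L)) (precedes_trans consV sS Ls Li) (in2W (precedes_total V L)))).
apply: eq_bigr => x; rewrite inE => /andP[xL xs].
by rewrite mulr1z edge_start_cup.
Qed.

End Homotopy.

Lemma subsetDD1 (I : finType) (s L A : {set I}) v :
  A \subset s :\: L -> A :\ v \subset s :\ v :\: L.
Proof.
move/subsetP=> As; apply/subsetP => z; rewrite !inE => /andP[-> /As].
by rewrite !inE => /andP[-> ->].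
Qed.

(** * Coefficients of boundaries *)

Section Coefficients.

Variables (n : nat) (S : {set {set 'I_n.+1}}).
Hypothesis HS : simplicial_complex S.
Implicit Types (s L A P Q U M V W K X Y : {set 'I_n.+1}).

(** The coefficient carries the sign of [term], which makes these functionals dual to the terms. *)
Definition term_coef V K A : {additive chain2 S -> int} :=
  linext (fun p : simplex S * simplex S =>
    ((val p.1 == K :|: A) && (val p.2 == K :|: (V :\: (K :|: A))))%:R
      *~ (-1) ^+ cup_sign V K A (V :\: (K :|: A))).

Lemma term_coef_mono V K A X Y : X \in S -> Y \in S ->
  term_coef V K A (mono S X Y) =
    ((X == K :|: A) && (Y == K :|: (V :\: (K :|: A))))%:R
      *~ (-1) ^+ cup_sign V K A (V :\: (K :|: A)).
Proof.
move=> XS YS; have [p [<- <-]] := pair_simplex XS YS.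
exact: (linext_mono _ p).
Qed.

Lemma setI_comps V K A : K \subset V -> A \subset V :\: K ->
  (K :|: A) :&: (K :|: (V :\: (K :|: A))) = K.
Proof.
move=> KV AV; apply/setP => z; rewrite !inE.
by case: (z \in K); case: (z \in A); rewrite //= ?andbF.
Qed.

Lemma setU_comps V K A : K \subset V -> A \subset V :\: K ->
  (K :|: A) :|: (K :|: (V :\: (K :|: A))) = V.
Proof.
move=> KV AV; apply/setP => z; rewrite !inE.
have := subsetP KV z; have := subsetP AV z; rewrite !inE.
case: (z \in K); case: (z \in A); case: (z \in V) => //= H1 H2;
  first [by have := H1 isT | by have := H2 isT].
Qed.

Lemma setD_comps V K A : K \subset V -> A \subset V :\: K ->
  (K :|: A) :\: (K :|: (V :\: (K :|: A))) = A.
Proof.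
move=> KV AV; apply/setP => z; rewrite !inE.
have := subsetP KV z; have := subsetP AV z; rewrite !inE.
case: (z \in K); case: (z \in A); case: (z \in V) => //= H1 H2;
  first [by have := H1 isT | by have := H2 isT].
Qed.

(** Union, intersection and difference of the two factors recover [V], [K] and [A], so distinct
    indices give distinct basis elements. *)
Lemma term_coef_term V K A V' K' A' :
  K \subset V -> A \subset V :\: K -> K' \subset V' -> A' \subset V' :\: K' ->
  K :|: A \in S -> K :|: (V :\: (K :|: A)) \in S ->
  term_coef V K A (term S V' K' A') = [&& V == V', K == K' & A == A']%:R.
Proof.
move=> KV AV KV' AV' XS YS.
have E : (K' :|: A' == K :|: A) && (K' :|: (V' :\: (K' :|: A')) == K :|: (V :\: (K :|: A)))
    = [&& V == V', K == K' & A == A'].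
  apply/andP/and3P => [[/eqP EX /eqP EY]|[/eqP-> /eqP-> /eqP->] //].
  split; apply/eqP.
  - by rewrite -(setU_comps KV AV) -EY -EX setU_comps.
  - by rewrite -(setI_comps KV AV) -EY -EX setI_comps.
  - by rewrite -(setD_comps KV AV) -EY -EX setD_comps.
rewrite /term raddfMz.
have [XS'|XS'] := boolP (K' :|: A' \in S); last first.
  rewrite mono_notinl // raddf0 mul0rz -E; case: eqP => // EX.
  by rewrite EX XS in XS'.
have [YS'|YS'] := boolP (K' :|: (V' :\: (K' :|: A')) \in S); last first.
  rewrite mono_notinr // raddf0 mul0rz -E andbC; case: eqP => // EY.
  by rewrite EY YS in YS'.
rewrite term_coef_mono // E; case: and3P => [[/eqP-> /eqP-> /eqP->]|_].
  exact: mulrz_signK.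
by rewrite !mul0rz.
Qed.

Lemma term_mono X Y :
  mono S X Y = term S (X :|: Y) (X :&: Y) (X :\: Y)
    *~ (-1) ^+ cup_sign (X :|: Y) (X :&: Y) (X :\: Y)
                        ((X :|: Y) :\: ((X :&: Y) :|: (X :\: Y))).
Proof.
rewrite /term mulrz_signK setID; congr mono.
by apply/setP => z; rewrite !inE; case: (z \in X); case: (z \in Y).
Qed.

(** Summing over all [A] gives every vertex of the cube the same weight, so that start minus end of
    an edge counts 0. *)
Definition total_coef V K (y : chain2 S) : int :=
  \sum_(A : {set 'I_n.+1} | A \subset V :\: K) term_coef V K A y.

Fact total_coef_is_additive V K : zmod_morphism (total_coef V K).
Proof.
by move=> x y; rewrite /total_coef -sumrB; apply: eq_bigr => A _; rewrite raddfB.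
Qed.

HB.instance Definition _ V K :=
  GRing.isZmodMorphism.Build (chain2 S) int (total_coef V K) (total_coef_is_additive V K).

Lemma total_coef_subz V K x y (z : int) :
  total_coef V K x = total_coef V K y -> total_coef V K ((x - y) *~ z) = 0.
Proof. by move=> e; rewrite raddfMz raddfB /= e subrr mul0rz. Qed.

Lemma total_coef_term V K V' K' A' : V \in S -> K \subset V -> K != set0 ->
  K' \subset V' -> A' \subset V' :\: K' ->
  total_coef V K (term S V' K' A') = ((V == V') && (K == K'))%:R.
Proof.
move=> VS KV K0 KV' AV'; rewrite /total_coef.
transitivity (\sum_(A : {set 'I_n.+1} | A \subset V :\: K)
  [&& V == V', K == K' & A == A']%:R : int).
  apply: eq_bigr => A AV; have [XS YS] := term_comps HS VS KV AV K0.
  exact: term_coef_term.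
case: eqP => [->|_]; last by rewrite big1.
case: eqP => [->|_]; last by rewrite big1.
rewrite (bigD1 A') //= eqxx big1 ?addr0 // => A /andP[_ /negPf] -> //.
Qed.

Lemma bd2_mono_term X Y : X \in S -> Y \in S -> X :&: Y != set0 ->
  bd2 S (mono S X Y) =
    (\sum_(v in (X :|: Y) :\: (X :&: Y))
       term S ((X :|: Y) :\ v) (X :&: Y) (X :\: Y :\ v)
         *~ (-1) ^+ (#|X :&: Y|.-1 + card_lt (X :|: Y) v)
    + \sum_(x in X :&: Y) (term S (X :|: Y) (X :&: Y :\ x) (X :\: Y)
         - term S (X :|: Y) (X :&: Y :\ x) (x |: (X :\: Y)))
         *~ (-1) ^+ (#|X :&: Y|.-1 + card_lt (X :&: Y) x))
    *~ (-1) ^+ cup_sign (X :|: Y) (X :&: Y) (X :\: Y)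
                        ((X :|: Y) :\: ((X :&: Y) :|: (X :\: Y))).
Proof.
move=> XS YS K0.
have EX : (X :&: Y) :|: (X :\: Y) = X by rewrite setID.
have EY : (X :&: Y) :|: ((X :|: Y) :\: X) = Y.
  by apply/setP => z; rewrite !inE; case: (z \in X); case: (z \in Y).
have sK : X :&: Y \subset X :|: Y by apply: subset_trans (subsetIl _ _) (subsetUl _ _).
have sA : X :\: Y \subset (X :|: Y) :\: (X :&: Y).
  by apply/subsetP => z; rewrite !inE; case: (z \in X); case: (z \in Y).
have := bd2_term HS sK sA K0; rewrite EX EY => /(_ XS YS) E.
by rewrite {1}term_mono raddfMz EX E.
Qed.

(* The edges parallel to a fixed direction cancel in pairs, so only the faces
   opposite to a vertex outside of the intersection are seen. *)
Lemma total_coef_bd2 W L X Y : W \in S -> L \subset W -> L != set0 ->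
  X \in S -> Y \in S -> total_coef W L (bd2 S (mono S X Y)) != 0 ->
  X :&: Y = L /\ exists2 w, w \notin W & X :|: Y = w |: W.
Proof.
move=> WS LW L0 XS YS.
have tc0 X' Y' : X' :&: Y' = set0 -> total_coef W L (mono S X' Y') = 0.
  move=> E; rewrite term_mono raddfMz E /= total_coef_term ?sub0set //.
    by rewrite (negPf L0) andbF mul0rz.
  by apply/subsetP => z; rewrite !inE; case: (z \in X') => //=; rewrite andbF.
(* [bd2_mono_term] needs a non-empty intersection. Disjoint factors have disjoint faces, which a
   non-empty [L] does not see. *)
have [K0|K0] := eqVneq (X :&: Y) set0.
  rewrite bd2_mono // raddfD !raddf_sum !big1 ?addr0 ?eqxx // => v vX;
    rewrite raddfMz /= tc0 ?mul0rz //.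
    by apply/eqP; rewrite -subset0 -K0 setIS // subsetDl.
  by apply/eqP; rewrite -subset0 -K0 setSI // subsetDl.
have sK : X :&: Y \subset X :|: Y by apply: subset_trans (subsetIl _ _) (subsetUl _ _).
have sA : X :\: Y \subset (X :|: Y) :\: (X :&: Y).
  by apply/subsetP => z; rewrite !inE; case: (z \in X); case: (z \in Y).
rewrite bd2_mono_term // raddfMz raddfD !raddf_sum /= [X in _ + X]big1 ?addr0 => [|x xK].
  move=> H; have [v] : exists2 v, v \in (X :|: Y) :\: (X :&: Y) & total_coef W L
       (term S ((X :|: Y) :\ v) (X :&: Y) (X :\: Y :\ v)
         *~ (-1) ^+ (#|X :&: Y|.-1 + card_lt (X :|: Y) v)) != 0.
    apply/exists_inP; apply: contraNT H; rewrite negb_exists_in => /forall_inP H.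
    by rewrite big1 ?mul0rz // => v /H; rewrite negbK => /eqP.
  rewrite inE => /andP[vK vV]; rewrite raddfMz /= total_coef_term //.
  - case: (W =P _) => [EW|_]; last by rewrite /= mul0rz eqxx.
    case: (L =P _) => [->|_]; last by rewrite /= mul0rz eqxx.
    by split=> //; exists v; rewrite EW ?setD11 ?setD1K.
  - by rewrite subsetD1 sK vK.
  - exact: subsetDD1.
have [xX xY] : x \in X /\ x \in Y by apply/andP; rewrite -in_setI.
have sKx : X :&: Y :\ x \subset X :|: Y by apply: subset_trans (subsetDl _ _) sK.
have sAx : X :\: Y \subset (X :|: Y) :\: (X :&: Y :\ x).
  by apply: subset_trans sA _; apply: setDS; exact: subsetDl.
have sAx' : x |: (X :\: Y) \subset (X :|: Y) :\: (X :&: Y :\ x).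
  by rewrite subUset sAx sub1set !inE eqxx xX.
apply: total_coef_subz.
exact: etrans (total_coef_term WS LW L0 sKx sAx) (esym (total_coef_term WS LW L0 sKx sAx')).
Qed.

End Coefficients.

(** * The boundary of D s when D is known on the proper faces *)

Section FaceCoefficients.

Variables (n : nat) (S : {set {set 'I_n.+1}}).
Hypothesis HS : simplicial_complex S.
Variables (i : nat) (D : {additive chain S -> chain2 S}).
Hypothesis homD : homotopy_formula i D.
Implicit Types (s t L A P Q U M W K X Y : {set 'I_n.+1}) (V : {set {set 'I_n.+1}}).

Lemma term_coef_sum W K A t (At : {set 'I_n.+1} -> {set 'I_n.+1}) (c : {set 'I_n.+1} -> int) :
  K \subset W -> A \subset W :\: K ->
  K :|: A \in S -> K :|: (W :\: (K :|: A)) \in S ->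
  (forall L, L \subset t -> #|L| = i.+1 -> At L \subset t :\: L) ->
  term_coef S W K A (\sum_(L : {set 'I_n.+1} | (L \subset t) && (#|L| == i.+1))
     term S t L (At L) *~ c L)
  = if [&& W == t, #|K| == i.+1 & A == At K] then c K else 0.
Proof.
move=> KW AW XS YS Asub; rewrite raddf_sum /=.
transitivity (\sum_(L : {set 'I_n.+1} | (L \subset t) && (#|L| == i.+1))
   ([&& W == t, K == L & A == At L]%:R : int) *~ c L).
  by apply: eq_bigr => L /andP[Lt /eqP Li]; rewrite raddfMz term_coef_term ?Asub.
case: (W =P t) => [EW|_]; last by rewrite big1 // => L _; rewrite mul0rz.
case: (#|K| =P i.+1) => [EK|NK] /=; last first.
  by rewrite big1 // => L /andP[_ /eqP Li];
    case: (K =P L) => [E|_]; [case: NK; rewrite E | rewrite mul0rz].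
rewrite (bigD1 K) /=; last by rewrite -EW KW EK eqxx.
rewrite eqxx big1 => [|L /andP[_ /negPf nLK]]; last by rewrite eq_sym nLK mul0rz.
by rewrite addr0; case: eqP => //; rewrite ?mul0rz ?intz.
Qed.

Lemma term_coef_cup W K A t V : K \subset W -> A \subset W :\: K ->
  K :|: A \in S -> K :|: (W :\: (K :|: A)) \in S ->
  term_coef S W K A (cup_simplex S i V t)
  = [&& W == t, #|K| == i.+1 & A == cupA V t K]%:R.
Proof.
move=> KW AW XS YS; have := @term_coef_sum W K A t (cupA V t) (fun=> 1) KW AW XS YS.
rewrite cup_simplexE; under eq_bigr => L _ do rewrite mulr1z.
by move=> ->; [case: ifP | move=> L _ _; apply: cupA_sub].
Qed.

Definition agrees_on_faces V s : Prop :=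
  forall t, t \in S -> t \proper s -> D (cell S t) = cup_simplex S i V t.

Lemma bd2_agrees V s : s \in S -> agrees_on_faces V s ->
  bd2 S (D (cell S s)) =
    \sum_(v in s) cup_simplex S i V (s :\ v) *~ (-1) ^+ (card_lt s v + i)
    + \sum_(L : {set 'I_n.+1} | (L \subset s) && (#|L| == i))
        (vertex S s L set0 - vertex S s L (s :\: L)).
Proof.
move=> sS agr; rewrite ((homotopy_formula_cell HS i D).2 homD s sS) (additive_bd HS sS agr).
congr (_ + _); rewrite mulrz_suml; apply: eq_bigr => v _; exact: mulrz_sign.
Qed.

Lemma term_coef_bd2_agrees V s W K A : s \in S -> agrees_on_faces V s ->
  K \subset W -> A \subset W :\: K ->
  K :|: A \in S -> K :|: (W :\: (K :|: A)) \in S ->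
  term_coef S W K A (bd2 S (D (cell S s))) =
    \sum_(v in s) ([&& W == s :\ v, #|K| == i.+1 & A == cupA V (s :\ v) K]%:R : int)
       *~ (-1) ^+ (card_lt s v + i)
    + if (W == s) && (#|K| == i)
      then (A == twist s K set0)%:R - (A == twist s K (s :\: K))%:R else 0.
Proof.
move=> sS agr KW AW XS YS; rewrite (bd2_agrees sS agr) raddfD !raddf_sum.
congr (_ + _).
  by apply: eq_bigr => v vs; rewrite raddfMz term_coef_cup.
transitivity (\sum_(L : {set 'I_n.+1} | (L \subset s) && (#|L| == i))
   ([&& W == s, K == L & A == twist s L set0]%:R
    - [&& W == s, K == L & A == twist s L (s :\: L)]%:R : int)).
  apply: eq_bigr => L /andP[Ls _].
  rewrite (raddfB (term_coef S W K A)).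
  by congr (_ - _); apply: term_coef_term; rewrite ?twist_sub.
case: (W =P s) => [EW|_] /=; last by rewrite big1 // => L _; rewrite subrr.
case: (#|K| =P i) => [EK|NK] /=; last first.
  by rewrite big1 // => L /andP[_ /eqP Li];
    case: (K =P L) => [E|_]; [case: NK; rewrite E | rewrite subrr].
rewrite (bigD1 K) /=; last by rewrite -EW KW EK eqxx.
by rewrite eqxx big1 ?addr0 // => L /andP[_ /negPf nLK]; rewrite eq_sym nLK subrr.
Qed.

(** The facets of [s] are distinct and the cube vertices have union [s], so only the cup value on
    [s :\ v] contributes. *)
Lemma term_coef_facet V s v L A : s \in S -> agrees_on_faces V s -> v \in s ->
  L \subset s :\ v -> #|L| = i.+1 -> A \subset s :\ v :\: L ->
  term_coef S (s :\ v) L A (bd2 S (D (cell S s)))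
  = (A == cupA V (s :\ v) L)%:R *~ (-1) ^+ (card_lt s v + i).
Proof.
move=> sS agr vs Ls Li As.
have L0 : L != set0 by rewrite -card_gt0 Li.
have WS : s :\ v \in S.
  apply: (face_in HS sS); first exact: subsetDl.
  by apply: contraNneq L0 => E; rewrite -subset0 -E.
have [XS YS] := term_comps HS WS Ls As L0.
rewrite (term_coef_bd2_agrees sS agr) // Li eqxx.
have Nsv : (s :\ v == s) = false.
  by apply/negP => /eqP /setP /(_ v); rewrite !inE eqxx vs.
rewrite Nsv addr0 (bigD1 v) //= eqxx big1 ?addr0 // => u /andP[us uv].
have /negPf -> : s :\ v != s :\ u; last by rewrite mul0rz.
by apply/eqP => /setP /(_ u); rewrite !inE eqxx uv us.
Qed.

(** The total coefficient of the boundary at [s :\ v] and [L] is a single sign, so some term of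
    [D s] contributes to it, and [total_coef_bd2] restricts which terms can. *)
Lemma support_cover V s v L : s \in S -> agrees_on_faces V s -> v \in s ->
  L \subset s :\ v -> #|L| = i.+1 ->
  exists2 p, D (cell S s) p != 0 & val p.1 :&: val p.2 = L /\
    exists2 w, w \notin s :\ v & val p.1 :|: val p.2 = w |: (s :\ v).
Proof.
move=> sS agr vs Ls Li.
have L0 : L != set0 by rewrite -card_gt0 Li.
have WS : s :\ v \in S.
  apply: (face_in HS sS); first exact: subsetDl.
  by apply: contraNneq L0 => E; rewrite -subset0 -E.
have tot : total_coef (s :\ v) L (bd2 S (D (cell S s))) != 0.
  rewrite /total_coef (bigD1 (cupA V (s :\ v) L)) /= ?cupA_sub //.
  rewrite (term_coef_facet sS agr) ?cupA_sub // eqxx big1 => [|A /andP[As nA]].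
    by rewrite addr0 intz signr_eq0.
  by rewrite (term_coef_facet sS agr) // (negPf nA) mul0rz.
have := bd2_mono_sum (total_coef (s :\ v) L) (D (cell S s)); rewrite /= => E.
have [p np] : exists p, total_coef (s :\ v) L (bd2 S (mono S (val p.1) (val p.2)))
    *~ D (cell S s) p != 0.
  apply/existsP; apply: contraNT tot; rewrite negb_exists => /forallP H.
  by rewrite E big1 // => p _; have := H p; rewrite negbK => /eqP.
exists p; first by apply: contraNneq np => ->; rewrite mulr0z.
apply: (total_coef_bd2 HS WS Ls L0 (valP p.1) (valP p.2)).
by apply: contraNneq np => ->; rewrite mul0rz.
Qed.

End FaceCoefficients.

Lemma imset_cover (T1 T2 : finType) (f : T1 -> T2) (P : {set T1}) (T : {set T2}) :
  T \subset f @: P -> (#|P| <= #|T|)%N -> f @: P = T /\ {in P &, injective f}.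
Proof.
move=> sT cP.
have E : #|f @: P| = #|P|.
  by apply/eqP; rewrite eqn_leq leq_imset_card (leq_trans cP) ?subset_leq_card.
split; last by apply/imset_injP; rewrite E.
by apply/esym/eqP; rewrite eqEcard sT E.
Qed.

(** * The shape of a minimal coproduct *)

Section Shape.

Variables (n : nat) (S : {set {set 'I_n.+1}}).
Hypothesis HS : simplicial_complex S.
Variables (i : nat) (D : {additive chain S -> chain2 S}).
Hypothesis homD : homotopy_formula i D.
Implicit Types (t L A P Q U M W K X Y : {set 'I_n.+1}).
Variables (V : {set {set 'I_n.+1}}) (s : {set 'I_n.+1}).
Hypotheses (sS : s \in S) (agr : agrees_on_faces i D V s).

Lemma term_coef_bd2_sum W K A (At : {set 'I_n.+1} -> {set 'I_n.+1})
    (c : {set 'I_n.+1} -> int) :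
  K \subset W -> A \subset W :\: K ->
  K :|: A \in S -> K :|: (W :\: (K :|: A)) \in S ->
  (forall L, L \subset s -> #|L| = i.+1 -> At L \subset s :\: L) ->
  term_coef S W K A (bd2 S (\sum_(L : {set 'I_n.+1} | (L \subset s) && (#|L| == i.+1))
     term S s L (At L) *~ c L))
  = \sum_(v in s) (if [&& W == s :\ v, #|K| == i.+1 & A == At K :\ v] then c K else 0)
      *~ (-1) ^+ (i + card_lt s v)
  + (if (W == s) && (#|K| == i) then \sum_(x in s :\: K)
      ((A == twist s K (edge_start s K x (At (x |: K))))%:R
       - (A == twist s K (x |: edge_start s K x (At (x |: K))))%:R) *~ c (x |: K) else 0).
Proof.
move=> KW AW XS YS Asub; rewrite (bd2_sum_term HS c sS Asub) raddfD !raddf_sum.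
congr (_ + _).
  apply: eq_bigr => v vs; rewrite raddfMz (term_coef_sum c KW AW XS YS) // => L Lsv Li.
  by apply: subsetDD1; apply: Asub => //; apply: subset_trans Lsv (subsetDl _ _).
transitivity (\sum_(L : {set 'I_n.+1} | (L \subset s) && (#|L| == i)) \sum_(x in s :\: L)
   ([&& W == s, K == L & A == twist s L (edge_start s L x (At (x |: L)))]%:R
    - [&& W == s, K == L & A == twist s L (x |: edge_start s L x (At (x |: L)))]%:R : int)
     *~ c (x |: L)).
  apply: eq_bigr => L /andP[Ls _]; rewrite raddf_sum; apply: eq_bigr => x _.
  rewrite raddfMz (raddfB (term_coef S W K A)); congr ((_ - _) *~ _);
    by apply: term_coef_term; rewrite ?twist_sub.
case: (W =P s) => [EW|_] /=; last first.
  by rewrite big1 // => L _; rewrite big1 // => x _; rewrite subrr mul0rz.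
case: (#|K| =P i) => [EK|NK] /=; last first.
  rewrite big1 // => L /andP[_ /eqP Li]; rewrite big1 // => x _.
  by case: (K =P L) => [E|_]; [case: NK; rewrite E | rewrite subrr mul0rz].
rewrite (bigD1 K) /=; last by rewrite -EW KW EK eqxx.
rewrite [X in _ + X]big1 ?addr0 => [|L /andP[_ /negPf nLK]].
  by apply: eq_bigr => x _; rewrite eqxx.
by rewrite big1 // => x _; rewrite eq_sym nLK subrr mul0rz.
Qed.

Hypotheses (cs : (i.+2 <= #|s|)%N)
  (few : (nterms (D (cell S s)) <= 'C(#|s|, i.+1))%N).

Let supp := [set p : simplex S * simplex S | D (cell S s) p != 0].
Let inter (p : simplex S * simplex S) : {set 'I_n.+1} := val p.1 :&: val p.2.
Let draws := [set L : {set 'I_n.+1} | L \subset s & #|L| == i.+1].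

Lemma draw_complement L : L \in draws -> exists2 v, v \in s & L \subset s :\ v.
Proof.
rewrite inE => /andP[Ls /eqP Li].
have : (0 < #|s :\: L|)%N by rewrite cardsD (setIidPr Ls) Li subn_gt0.
rewrite card_gt0 => /set0Pn[v]; rewrite inE => /andP[vL vs].
by exists v => //; rewrite subsetD1 Ls.
Qed.

(** Each [L] misses a vertex of [s], so [support_cover] yields a term for it; [few] leaves room for
    only one. *)
Lemma supp_inter : inter @: supp = draws /\ {in supp &, injective inter}.
Proof.
apply: imset_cover; last by rewrite cards_draws.
apply/subsetP => L Ld; have [v vs Lv] := draw_complement Ld.
move: Ld; rewrite inE => /andP[_ /eqP Li].
have [p Dp [E _]] := support_cover HS homD sS agr vs Lv Li.
by apply/imsetP; exists p; rewrite ?inE.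
Qed.

(** The term that [support_cover] gives for [v] has the intersection of [p], so it is [p]: every
    such [v] constrains the same union. *)
Lemma supp_union_cover p v : p \in supp -> v \in s -> v \notin inter p ->
  exists2 w, w \notin s :\ v & val p.1 :|: val p.2 = w |: (s :\ v).
Proof.
move=> pP vs vp; have [im inj] := supp_inter.
have : inter p \in draws by rewrite -im; apply: imset_f.
rewrite inE => /andP[Ls /eqP Li].
have Lv : inter p \subset s :\ v by rewrite subsetD1 Ls.
have [q Dq [E H]] := support_cover HS homD sS agr vs Lv Li.
have <- : q = p by apply: inj => //; rewrite inE.
by [].
Qed.

Lemma term_coef_bd2_lower W K A X Y : X \in S -> Y \in S -> X :&: Y != set0 ->
  K \subset W -> A \subset W :\: K ->
  K :|: A \in S -> K :|: (W :\: (K :|: A)) \in S -> K != X :&: Y ->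
  term_coef S W K A (bd2 S (mono S X Y)) =
  (\sum_(x in X :&: Y) ([&& W == X :|: Y, K == X :&: Y :\ x & A == X :\: Y]%:R
     - [&& W == X :|: Y, K == X :&: Y :\ x & A == x |: (X :\: Y)]%:R : int)
       *~ (-1) ^+ (#|X :&: Y|.-1 + card_lt (X :&: Y) x))
    *~ (-1) ^+ cup_sign (X :|: Y) (X :&: Y) (X :\: Y)
                        ((X :|: Y) :\: ((X :&: Y) :|: (X :\: Y))).
Proof.
move=> XS YS K0 KW AW XAS YAS nK.
have sK : X :&: Y \subset X :|: Y by apply: subset_trans (subsetIl _ _) (subsetUl _ _).
have sA : X :\: Y \subset (X :|: Y) :\: (X :&: Y).
  by apply/subsetP => z; rewrite !inE; case: (z \in X); case: (z \in Y).
rewrite bd2_mono_term // raddfMz raddfD !raddf_sum; congr (_ *~ _).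
rewrite big1 ?add0r => [|v].
  apply: eq_bigr => x xK; rewrite raddfMz (raddfB (term_coef S W K A)).
  have sKx : X :&: Y :\ x \subset X :|: Y by apply: subset_trans (subsetDl _ _) sK.
  have sAx : X :\: Y \subset (X :|: Y) :\: (X :&: Y :\ x).
    by apply: subset_trans sA _; apply: setDS; exact: subsetDl.
  have sAx' : x |: (X :\: Y) \subset (X :|: Y) :\: (X :&: Y :\ x).
    rewrite subUset sAx sub1set !inE eqxx.
    by move: xK; rewrite inE => /andP[->].
  by congr ((_ - _) *~ _); apply: term_coef_term.
rewrite inE => /andP[vK vV]; rewrite raddfMz term_coef_term //.
- by rewrite (negPf nK) andbF mul0rz.
- by rewrite subsetD1 sK vK.
- exact: subsetDD1.
Qed.

(* In the smallest case #|s| = i + 2, a term of the support could still leave s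
   through one vertex w. The faces of that term containing w could only be
   cancelled by a term with the same intersection, of which there is none. *)
Lemma supp_union p : p \in supp -> val p.1 :|: val p.2 = s.
Proof.
move=> pP; have [im inj] := supp_inter.
have : inter p \in draws by rewrite -im; apply: imset_f.
move=> Ld; have [v vs Lv] := draw_complement Ld.
move: Ld; rewrite inE => /andP[Ls /eqP Li].
have vL : v \notin inter p by move: Lv; rewrite subsetD1 => /andP[].
have [w wsv EV] := supp_union_cover pP vs vL.
have [Ewv|nwv] := eqVneq w v; first by rewrite EV Ewv setD1K.
have ws : w \notin s by move: wsv; rewrite !inE nwv.
have cV : #|val p.1 :|: val p.2| = #|s|.
  by rewrite EV cardsU1 wsv [RHS](cardsD1 v) vs.
(* If the intersection is smaller than [s :\ v], another vertex [u] outside it shows that the union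
   also contains [v], hence [s], and the cardinals agree. *)
have [EL|nL] := eqVneq (inter p) (s :\ v); last first.
  have /properP[_ [u]] : inter p \proper s :\ v by rewrite properEneq nL.
  rewrite in_setD1 => /andP[uv us] uL.
  have [w' _ EV'] := supp_union_cover pP us uL.
  have vU : v \in val p.1 :|: val p.2 by rewrite EV' !inE (eq_sym v u) uv vs orbT.
  have svU : s :\ v \subset val p.1 :|: val p.2 by rewrite EV subsetUr.
  by apply/esym/eqP; rewrite eqEcard cV leqnn andbT -{1}(setD1K vs) subUset sub1set vU svU.
have L0 : inter p != set0 by rewrite -card_gt0 Li.
have [u uL] := set0Pn _ L0.
have [uX uY] : u \in val p.1 /\ u \in val p.2 by apply/andP; rewrite -in_setI.
have wL : w \notin inter p by apply: contra ws => /(subsetP Ls).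
pose X := val p.1; pose Y := val p.2; pose K := X :&: Y :\ u.
have KV : K \subset X :|: Y.
  by apply: subset_trans (subsetDl _ _) _; apply: subset_trans (subsetIl _ _) (subsetUl _ _).
(* Of the two ends of the edge in direction [u], take the one that deletes [u] from a factor
   containing [w]: that factor stays non-empty, even if [K] is empty. *)
have [A [AV XS YS nA]] : exists A, [/\ A \subset (X :|: Y) :\: K, K :|: A \in S,
    K :|: ((X :|: Y) :\: (K :|: A)) \in S
    & (A == X :\: Y)%:R - (A == u |: (X :\: Y))%:R != 0 :> int].
  have nuA : (X :\: Y == u |: (X :\: Y)) = false.
    by apply/negP => /eqP /setP /(_ u); rewrite !inE eqxx uX uY.
  have wV : w \in X :|: Y by rewrite EV setU11.
  have wu : w != u by apply: contraNneq wL => ->.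
  have [wX|wX] := boolP (w \in X).
    have EX : K :|: (X :\: Y) = X :\ u.
      apply/setP => z; rewrite !inE; have [->|_] := eqVneq z u; first by rewrite uY.
      by case: (z \in X); case: (z \in Y).
    have EY : K :|: ((X :|: Y) :\: (X :\ u)) = Y.
      apply/setP => z; rewrite !inE; have [->|_] := eqVneq z u; first by rewrite uX uY.
      by case: (z \in X); case: (z \in Y).
    exists (X :\: Y); rewrite EX EY eqxx nuA (valP p.2); split=> //.
      apply/subsetP => z; rewrite !inE; have [->|_] := eqVneq z u; first by rewrite uY.
      by case: (z \in X); case: (z \in Y).
    apply: (face_in HS (valP p.1)); first exact: subsetDl.
    by apply/set0Pn; exists w; rewrite !inE wu.
  have EX : K :|: (u |: (X :\: Y)) = X.
    apply/setP => z; rewrite !inE; have [->|_] := eqVneq z u; first by rewrite uX.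
    by case: (z \in X); case: (z \in Y).
  have EY : K :|: ((X :|: Y) :\: X) = Y :\ u.
    apply/setP => z; rewrite !inE; have [->|_] := eqVneq z u; first by rewrite uX.
    by case: (z \in X); case: (z \in Y).
  exists (u |: (X :\: Y)); rewrite EX EY eqxx (eq_sym (u |: _)) nuA (valP p.1); split=> //.
    apply/subsetP => z; rewrite !inE; have [->|_] := eqVneq z u; first by rewrite uX.
    by case: (z \in X); case: (z \in Y).
  apply: (face_in HS (valP p.2)); first exact: subsetDl.
  apply/set0Pn; exists w; rewrite !inE wu /=.
  by move: wV; rewrite inE (negPf wX).
have wV : w \in X :|: Y by rewrite EV setU11.
(* The boundary of [D s] only has unions inside [s], and [w] is outside. *)
have T0 : term_coef S (X :|: Y) K A (bd2 S (D (cell S s))) = 0.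
  rewrite (term_coef_bd2_agrees HS homD sS agr KV AV XS YS).
  have -> : (X :|: Y == s) = false by apply: contraNF ws => /eqP <-.
  rewrite addr0 big1 // => v' _.
  have -> : (X :|: Y == s :\ v') = false; last by rewrite mul0rz.
  by apply: contraNF ws => /eqP E; move: wV; rewrite E inE => /andP[].
have cK : #|K| = i by move: Li; rewrite (cardsD1 u) uL => -[].
have nK q : q \in supp -> K != inter q.
  move=> qP; have : inter q \in draws by rewrite -im; apply: imset_f.
  rewrite inE => /andP[_ /eqP ci]; apply: contra_eqN ci => /eqP <-.
  by rewrite cK neq_ltn ltnSn.
have nint q : q \in supp -> inter q != set0.
  move=> qP; have : inter q \in draws by rewrite -im; apply: imset_f.
  by rewrite inE -card_gt0 => /andP[_ /eqP ->].
have Hp : term_coef S (X :|: Y) K A (bd2 S (mono S (val p.1) (val p.2))) = 0.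
  move: T0; rewrite bd2_mono_sum (bigD1 p) //= big1 => [|q nqp].
    rewrite addr0 => /eqP; rewrite -mulrzr mulf_eq0 intz => /orP[/eqP //|].
    by move: pP; rewrite inE => /negPf ->.
  (* A second term with an end here would have the same union, so its intersection, of cardinal i+1
     inside [s], would be [s :\ v], the one of [p]. *)
  have [qP|] := boolP (q \in supp); last by rewrite inE negbK => /eqP ->.
  rewrite term_coef_bd2_lower ?(valP q.1) ?(valP q.2) ?nint ?nK //.
  rewrite big1 ?mul0rz // => x xq.
  case: (_ =P val q.1 :|: val q.2) => [EW|_]; last by rewrite subrr mul0rz.
  have : inter q \in draws by rewrite -im; apply: imset_f.
  rewrite inE => /andP[qs /eqP ci].
  case/eqP: nqp; apply: inj => //; apply/eqP; rewrite eqEcard ci Li leqnn andbT.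
  rewrite EL; apply/subsetP => z zq; have zs := subsetP qs z zq.
  have : z \in X :|: Y by rewrite EW inE; move: zq; rewrite inE => /andP[->].
  rewrite EV !inE zs andbT => /orP[/eqP E|//].
  by rewrite -E zs in ws.
move: Hp; rewrite term_coef_bd2_lower ?(valP p.1) ?(valP p.2) ?nK //.
rewrite (bigD1 u) //= big1 => [|x /andP[xL xu]].
  rewrite addr0 !eqxx /= => /eqP.
  by rewrite -mulrzA -mulrzr mulf_eq0 (negPf nA) intz mulf_eq0 !signr_eq0.
have -> : (X :&: Y :\ u == X :&: Y :\ x) = false; last by rewrite andbF subrr mul0rz.
apply/negP => /eqP /setP /(_ x); by rewrite !in_setD1 xu xL eqxx.
Qed.

Lemma value_expansion : exists (At : {set 'I_n.+1} -> {set 'I_n.+1}) (c : {set 'I_n.+1} -> int),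
  (forall L, L \subset s -> #|L| = i.+1 -> At L \subset s :\: L) /\
  D (cell S s) = \sum_(L : {set 'I_n.+1} | (L \subset s) && (#|L| == i.+1))
    term S s L (At L) *~ c L.
Proof.
have [im inj] := supp_inter.
(* [g] inverts [inter] on the support; [p0] only fills the case where [pick] finds nothing. *)
pose p0 : simplex S * simplex S := (exist _ s sS, exist _ s sS).
pose g L := odflt p0 [pick p in supp | inter p == L].
have gK p : p \in supp -> g (inter p) = p.
  move=> pP; rewrite /g; case: pickP => [q /andP[qP /eqP E]|/(_ p)]; first exact: inj.
  by rewrite pP eqxx.
have gP L : L \in draws -> g L \in supp /\ inter (g L) = L.
  by rewrite -im => /imsetP[p pP ->]; rewrite gK.
pose At L := val (g L).1 :\: val (g L).2.
exists At, (fun L => (-1) ^+ cup_sign s L (At L) (s :\: (L :|: At L)) * D (cell S s) (g L)).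
split=> [L Ls Li|].
  have [|gS E] := gP L; first by rewrite inE Ls Li eqxx.
  have : At L \subset (val (g L).1 :|: val (g L).2) :\: inter (g L).
    apply/subsetP => z; rewrite !inE.
    by case: (z \in val (g L).1); case: (z \in val (g L).2).
  by rewrite (supp_union gS) E.
rewrite [LHS]chain2_sum (bigID [in supp]) /= [X in _ + X]big1 ?addr0 => [|p]; last first.
  by rewrite inE negbK => /eqP ->.
transitivity (\sum_(L in draws) term S s L (At L)
    *~ ((-1) ^+ cup_sign s L (At L) (s :\: (L :|: At L)) * D (cell S s) (g L))).
  rewrite -im big_imset //; apply: eq_bigr => p pP.
  rewrite /At gK // [RHS]mulrzA.
  by have := term_mono S (val p.1) (val p.2); rewrite (supp_union pP) => ->.
by apply: eq_bigl => L; rewrite inE.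
Qed.

(** At [s :\ v] and [L] only the summand of [L] contributes to the boundary. It has to produce the
    cup term: a different [A] would give 0 instead of a sign, and the coefficient must be 1. *)
Lemma value_shape : exists At : {set 'I_n.+1} -> {set 'I_n.+1},
  [/\ forall L, L \subset s -> #|L| = i.+1 -> At L \subset s :\: L,
      forall L v, L \subset s -> #|L| = i.+1 -> v \in s :\: L ->
        At L :\ v = cupA V (s :\ v) L
    & D (cell S s) = \sum_(L : {set 'I_n.+1} | (L \subset s) && (#|L| == i.+1))
        term S s L (At L)].
Proof.
have [At [c [Asub E]]] := value_expansion.
have key L v : L \subset s -> #|L| = i.+1 -> v \in s :\: L ->
    At L :\ v = cupA V (s :\ v) L /\ c L = 1.
  move=> Ls Li; rewrite inE => /andP[vL vs].
  have Lsv : L \subset s :\ v by rewrite subsetD1 Ls.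
  have L0 : L != set0 by rewrite -card_gt0 Li.
  have WS : s :\ v \in S.
    apply: (face_in HS sS); first exact: subsetDl.
    by apply: contraNneq L0 => E'; rewrite -subset0 -E'.
  have Csub := cupA_sub V (s :\ v) L.
  have [XS YS] := term_comps HS WS Lsv Csub L0.
  have := term_coef_facet HS homD sS agr vs Lsv Li Csub.
  rewrite E term_coef_bd2_sum // eqxx Li.
  have Nsv : (s :\ v == s) = false.
    by apply/negP => /eqP /setP /(_ v); rewrite !inE eqxx vs.
  rewrite Nsv addr0 (bigD1 v) //= !eqxx big1 => [|u /andP[us uv]]; last first.
    have /negPf -> : s :\ v != s :\ u; last by rewrite mul0rz.
    by apply/eqP => /setP /(_ u); rewrite !inE eqxx uv us.
  rewrite addr0 addnC /= => H; have := congr1 (fun z => z *~ (-1) ^+ (card_lt s v + i)) H.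
  by rewrite !mulrz_signK; case: eqP => [-> -> //|_ /esym/eqP]; rewrite oner_eq0.
exists At; split=> //.
  by move=> L v Ls Li vs; case: (key L v Ls Li vs).
rewrite E; apply: eq_bigr => L /andP[Ls /eqP Li].
have [|v vs] := @draw_complement L; first by rewrite inE Ls Li eqxx.
rewrite subsetD1 => /andP[_ vL].
have vsL : v \in s :\: L by rewrite inE vL vs.
by have [_ ->] := key L v Ls Li vsL; rewrite mulr1z.
Qed.

(** With two vertices outside of [L], each [z] differs from one of them, and its membership in
    [At L] is read off on the facet opposite to that one. *)
Lemma value_large : (i.+3 <= #|s|)%N -> D (cell S s) = cup_simplex S i V s.
Proof.
move=> cs3; have [At [Asub Afacet ->]] := value_shape.
rewrite cup_simplexE; apply: eq_bigr => L /andP[Ls /eqP Li]; congr term.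
have : (1 < #|s :\: L|)%N by rewrite cardsD (setIidPr Ls) Li ltn_subRL addn1.
move=> /card_gt1P[u [v [us vs uv]]].
apply/setP => z; have := Afacet L u Ls Li us; have := Afacet L v Ls Li vs.
rewrite -!cupAD1 => /setP/(_ z) + /setP/(_ z); rewrite !in_setD1.
by have [->|] := eqVneq z v => //; rewrite eq_sym uv.
Qed.

(** A conservation law: only the extreme vertices of the cube survive in the boundary, so at any
    other vertex [Q] as many edges start as end. *)
Lemma vertex_balance (At : {set 'I_n.+1} -> {set 'I_n.+1}) L Q :
  (forall K, K \subset s -> #|K| = i.+1 -> At K \subset s :\: K) ->
  D (cell S s) = \sum_(K : {set 'I_n.+1} | (K \subset s) && (#|K| == i.+1)) term S s K (At K) ->
  L \subset s -> #|L| = i -> Q \subset s :\: L -> Q != set0 -> Q != s :\: L ->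
  \sum_(x in s :\: L) ((Q == edge_start s L x (At (x |: L)))%:R
     - (Q == x |: edge_start s L x (At (x |: L)))%:R) = 0 :> int.
Proof.
move=> Asub E Ls Li Qs Q0 Q1.
have tQ P : P \subset s :\: L -> (twist s L Q == twist s L P) = (Q == P).
  by move=> Ps; apply/eqP/eqP => [|-> //]; apply: twist_inj.
(* For empty [L] the twist is trivial, and both factors are non-empty because [Q] is neither empty
   nor full. *)
have [XS YS] : L :|: twist s L Q \in S /\ L :|: (s :\: (L :|: twist s L Q)) \in S.
  have [E0|L0] := eqVneq L set0; last exact: (term_comps HS sS Ls (twist_sub s L Q) L0).
  have EQ : twist s L Q = Q.
    apply/setP => a; rewrite !inE E0 (_ : card_gt _ _ = 0%N) ?addbF ?inE.
      have := subsetP Qs a; rewrite E0 !inE.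
      by case: (a \in Q) => [/(_ isT) ->|]; rewrite ?andbF.
    by apply/eqP; rewrite cards_eq0; apply/eqP/setP => b; rewrite !inE.
  rewrite EQ E0 !set0U; split; apply: (face_in HS sS) => //; rewrite ?subsetDl //.
    by apply: subset_trans Qs (subsetDl _ _).
  rewrite setD_eq0; apply: contra Q1 => sQ.
  by rewrite eqEsubset Qs E0 setD0 sQ.
have := term_coef_bd2_agrees HS homD sS agr Ls (twist_sub s L Q) XS YS.
have {}E : D (cell S s) = \sum_(K : {set 'I_n.+1} | (K \subset s) && (#|K| == i.+1))
    term S s K (At K) *~ 1.
  by rewrite E; apply: eq_bigr => K _; rewrite mulr1z.
rewrite E (term_coef_bd2_sum (fun=> 1) Ls (twist_sub s L Q) XS YS Asub) Li !eqxx.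
have ni : (i == i.+1) = false by rewrite eqn_leq ltnn andbF.
rewrite ni !tQ ?sub0set // (negPf Q0) (negPf Q1) subrr /=.
rewrite big1 ?add0r => [|v _]; last by rewrite andbF mul0rz.
rewrite [X in _ = X + _]big1 ?addr0 => [|v _]; last by rewrite andbF mul0rz.
move=> H; rewrite -[RHS]H; apply: eq_bigr => x xs.
have sE : edge_start s L x (At (x |: L)) \subset s :\: L.
  by apply/subsetP => a; rewrite !inE => /andP[/andP[+ ->]] _; rewrite negb_or => /andP[_ ->].
by rewrite mulr1z !tQ // subUset sub1set xs.
Qed.

End Shape.

(** * Support and number of terms of the cup values *)

Section CupValues.

Variables (n : nat) (S : {set {set 'I_n.+1}}).
Hypothesis HS : simplicial_complex S.
Implicit Types (s t L A P Q U M W K X Y : {set 'I_n.+1}) (V : {set {set 'I_n.+1}}).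

Lemma term_coefE p y :
  term_coef S (val p.1 :|: val p.2) (val p.1 :&: val p.2) (val p.1 :\: val p.2) y
  = y p *~ (-1) ^+ cup_sign (val p.1 :|: val p.2) (val p.1 :&: val p.2)
      (val p.1 :\: val p.2)
      ((val p.1 :|: val p.2) :\: (val p.1 :&: val p.2 :|: val p.1 :\: val p.2)).
Proof.
set X := val p.1; set Y := val p.2.
have EY : X :&: Y :|: (X :|: Y) :\: X = Y.
  by apply/setP => z; rewrite !inE; case: (z \in X); case: (z \in Y).
have -> W K A : term_coef S W K A y = \sum_(q : simplex S * simplex S)
    ((val q.1 == K :|: A) && (val q.2 == K :|: (W :\: (K :|: A))))%:R
      *~ (-1) ^+ cup_sign W K A (W :\: (K :|: A)) *~ y q by [].
rewrite setID EY (bigD1 p) //= !eqxx big1 ?addr0 => [|q nqp].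
  by rewrite -mulrzA mulrC mulrzA intz.
have -> : (val q.1 == X) && (val q.2 == Y) = false; last by rewrite !mul0rz.
rewrite !(inj_eq val_inj); apply/negbTE; apply: contra nqp => /andP[/eqP E1 /eqP E2].
by rewrite [q]surjective_pairing E1 E2 -surjective_pairing.
Qed.

Lemma cup_support i V s p : s \in S ->
  (cup_simplex S i V s p != 0) =
  [&& val p.1 :|: val p.2 == s, #|val p.1 :&: val p.2| == i.+1
    & val p.1 :\: val p.2 == cupA V s (val p.1 :&: val p.2)].
Proof.
move=> sS; set X := val p.1; set Y := val p.2.
have EY : X :&: Y :|: (X :|: Y) :\: X = Y.
  by apply/setP => z; rewrite !inE; case: (z \in X); case: (z \in Y).
have KV : X :&: Y \subset X :|: Y by apply: subset_trans (subsetIl _ _) (subsetUl _ _).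
have AV : X :\: Y \subset (X :|: Y) :\: (X :&: Y).
  by apply/subsetP => z; rewrite !inE; case: (z \in X); case: (z \in Y).
have XS : X :&: Y :|: X :\: Y \in S by rewrite setID (valP p.1).
have YS : X :&: Y :|: ((X :|: Y) :\: (X :&: Y :|: X :\: Y)) \in S.
  by rewrite setID EY (valP p.2).
have := term_coef_cup i s V KV AV XS YS; rewrite term_coefE.
case: [&& _, _ & _] => [/= E|/eqP].
  by apply/negP => /eqP E0; move: E; rewrite E0 mul0rz.
by rewrite -mulrzr mulf_eq0 intz signr_eq0 orbF => ->.
Qed.

(** The intersection parametrizes the support: the union is [s], and [L] fixes [A]. *)
Lemma nterms_cup i V s : s \in S -> nterms (cup_simplex S i V s) = 'C(#|s|, i.+1).
Proof.
move=> sS; rewrite /nterms -cards_draws.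
have inj : {in [set p | cup_simplex S i V s p != 0] &,
    injective (fun p : simplex S * simplex S => val p.1 :&: val p.2)}.
  move=> p q; rewrite !inE !cup_support //.
  move=> /and3P[/eqP Up _ /eqP Ap] /and3P[/eqP Uq _ /eqP Aq] E.
  have E1 : val p.1 = val q.1.
    by rewrite -(setID (val p.1) (val p.2)) -(setID (val q.1) (val q.2)) Ap Aq E.
  have E2 : val p.2 = val q.2.
    have H (X Y : {set 'I_n.+1}) : Y = X :&: Y :|: (X :|: Y) :\: X.
      by apply/setP => z; rewrite !inE; case: (z \in X); case: (z \in Y).
    by rewrite (H (val p.1) (val p.2)) (H (val q.1) (val q.2)) E Up Uq E1.
  by rewrite [p]surjective_pairing [q]surjective_pairing (val_inj E1) (val_inj E2).
rewrite -(card_in_imset inj); apply: eq_card => L; rewrite inE.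
apply/imsetP/andP => [[p]|[Ls Li]].
  rewrite inE cup_support // => /and3P[/eqP <- cI _] ->; split=> //.
  by apply: subset_trans (subsetIl _ _) (subsetUl _ _).
have L0 : L != set0 by rewrite -card_gt0 (eqP Li).
have Csub := cupA_sub V s L.
have [XS YS] := term_comps HS sS Ls Csub L0.
have [p [E1 E2]] := pair_simplex XS YS.
exists p; last by rewrite E1 E2 setI_comps.
by rewrite inE cup_support // E1 E2 setI_comps // setU_comps // setD_comps // Li !eqxx.
Qed.

Lemma cup_simplex_ext i V V' s :
  (forall K, K \subset s -> #|K| = i.+2 -> (K \in V) = (K \in V')) ->
  cup_simplex S i V s = cup_simplex S i V' s.
Proof.
move=> E; rewrite !cup_simplexE; apply: eq_bigr => L /andP[Ls /eqP Li]; congr term.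
apply/setP => a; rewrite !inE; have [aL|//] := boolP (a \notin L).
have [as_|//] := boolP (a \in s).
by rewrite E ?subUset ?sub1set ?as_ // cardsU1 aL Li.
Qed.

Lemma cup_simplex_small i V s : (#|s| <= i)%N -> cup_simplex S i V s = 0.
Proof.
move=> si; rewrite cup_simplexE big1 // => L /andP[/subset_leq_card + /eqP Li].
by rewrite Li => /leq_trans /(_ si); rewrite ltnn.
Qed.

Lemma cup_simplex_top i V s : #|s| = i.+1 -> cup_simplex S i V s = term S s s set0.
Proof.
move=> si; rewrite cup_simplexE (bigD1 s) /=; last by rewrite subxx si eqxx.
rewrite big1 ?addr0 => [|L /andP[/andP[Ls Li] nLs]].
  congr term; apply/eqP; rewrite -subset0 -(setDv s); exact: cupA_sub.
by case/eqP: nLs; apply/eqP; rewrite eqEcard Ls si (eqP Li) leqnn.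
Qed.

Lemma has_degree_cup i V : has_degree i (cup S i V).
Proof.
move=> s p; rewrite cup_cell ?(valP s) // cup_support ?(valP s) //.
move=> /and3P[/eqP U /eqP I _]; rewrite /sdim.
have := cardsUI (val p.1) (val p.2); rewrite U I.
have := simplex_neq0 HS (valP p.1); have := simplex_neq0 HS (valP p.2).
have := simplex_neq0 HS (valP s); rewrite -!card_gt0.
move: #|val s| #|val p.1| #|val p.2| => a b c; lia.
Qed.

Lemma cup_vertex V s : s \in simplices S 0 ->
  cup S 0 V (cell S s) = tensor (cell S s) (cell S s).
Proof.
rewrite inE => /andP[sS s1]; rewrite cup_cell // (cup_simplex_top V (eqP s1)).
have [x ->] := cards1P s1.
rewrite /term /cup_sign setU0 setDv setU0 cards0 muln0 addn0 big_set0 add0n big_set1.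
rewrite -card_lt_same setDv card_ltE big_set0; exact: mulr1z.
Qed.

Lemma consistent0 j : consistent S j set0.
Proof. by split=> [|M _]; [exact: sub0set | left=> x y _ _ _; rewrite inE]. Qed.

Lemma admissible_cup0 i : admissible i (cup S i set0).
Proof.
split; [exact: has_degree_cup | exact: homotopy_cup (consistent0 _) |].
by move=> -> s sS; apply: cup_vertex.
Qed.

End CupValues.

(** * Simplices with i+1, i+2 and i+3 vertices *)

Section SmallSimplices.

Variables (n : nat) (S : {set {set 'I_n.+1}}).
Hypothesis HS : simplicial_complex S.
Variables (i : nat) (D : {additive chain S -> chain2 S}).
Hypothesis homD : homotopy_formula i D.
Implicit Types (t L A P Q U M W K X Y : {set 'I_n.+1}).
Variables (V : {set {set 'I_n.+1}}) (s : {set 'I_n.+1}).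
Hypotheses (sS : s \in S) (agr : agrees_on_faces i D V s).

Lemma term_coef_bd2_sub W K A X Y : X \in S -> Y \in S ->
  term_coef S W K A (bd2 S (mono S X Y)) != 0 ->
  K :|: A \subset X /\ K :|: (W :\: (K :|: A)) \subset Y.
Proof.
move=> XS YS; rewrite bd2_mono // raddfD.
have tc0 X' Y' : X' \subset X -> Y' \subset Y ->
    ~~ ((K :|: A \subset X) && (K :|: (W :\: (K :|: A)) \subset Y)) ->
    term_coef S W K A (mono S X' Y') = 0.
  move=> sX sY nE.
  have [XS'|XS'] := boolP (X' \in S); last by rewrite mono_notinl // raddf0.
  have [YS'|YS'] := boolP (Y' \in S); last by rewrite mono_notinr // raddf0.
  rewrite term_coef_mono //.
  have [/andP[/eqP EX /eqP EY]|_] := boolP (_ && _); last exact: mul0rz.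
  by case/negP: nE; rewrite -EY -EX sX sY.
move=> H; apply/andP; apply: contraNT H => nE.
rewrite (raddf_sum (term_coef S W K A)) (raddf_sum (term_coef S W K A)).
rewrite big1 ?add0r => [|v _]; last by rewrite raddfMz tc0 ?mul0rz // subsetDl.
by rewrite big1 // => v _; rewrite raddfMz tc0 ?mul0rz // subsetDl.
Qed.

(** The cube of [K] = [s :\ x] is a single edge, and both its ends occur in the boundary. The only
    term of [D s] must therefore contain [s] in both factors, and the degree makes it a multiple of
    s (x) s. *)
Lemma value_top : #|s| = i.+1 -> (0 < i)%N -> has_degree i D ->
  (nterms (D (cell S s)) <= 1)%N -> D (cell S s) = cup_simplex S i V s.
Proof.
move=> si i0 degD one; rewrite (cup_simplex_top S V si).
have [x xs] : exists x, x \in s by apply/set0Pn; exact: (simplex_neq0 HS sS).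
pose K := s :\ x.
have Ks : K \subset s by apply: subsetDl.
have cK : #|K| = i by move: si; rewrite (cardsD1 x) xs => -[].
have K0 : K != set0 by rewrite -card_gt0 cK.
have sK : s :\: K = [set x] by rewrite setDDr setDv set0U; apply/setIidPr; rewrite sub1set.
have coef A : A \subset [set x] -> term_coef S s K A (bd2 S (D (cell S s))) != 0.
  move=> Ax; have As : A \subset s :\: K by rewrite sK.
  have [XS YS] := term_comps HS sS Ks As K0.
  rewrite (term_coef_bd2_agrees HS homD sS agr Ks As XS YS) cK !eqxx.
  rewrite big1 => [|v _]; last first.
    by rewrite (_ : (i == i.+1) = false) ?andbF ?mul0rz // eqn_leq ltnn andbF.
  have tw P : P \subset [set x] -> twist s K P = set0 \/ twist s K P = [set x].
    by move=> _; have := twist_sub s K P; rewrite sK subset1 => /orP[] /eqP ->; [right|left].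
  have ntw : twist s K set0 != twist s K (s :\: K).
    apply/eqP => /twist_inj; rewrite sub0set subxx => /(_ isT isT) E.
    by move: (set11 x); rewrite -sK -E inE.
  have n0x : (set0 == [set x]) = false.
    by apply/negP => /eqP E; move: (set11 x); rewrite -E inE.
  move: ntw; rewrite add0r sK.
  have [-> | ->] := tw set0 (sub0set _); have [-> | ->] := tw [set x] (subxx _);
    rewrite ?eqxx // => _; move: Ax; rewrite subset1 => /orP[] /eqP ->;
    by rewrite !eqxx ?n0x ?(eq_sym [set x]) ?n0x.
have get A : A \subset [set x] -> exists2 p, D (cell S s) p != 0 &
    K :|: A \subset val p.1 /\ K :|: (s :\: (K :|: A)) \subset val p.2.
  move=> /coef; rewrite bd2_mono_sum => H.
  have [p np] : exists p, term_coef S s K A (bd2 S (mono S (val p.1) (val p.2)))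
      *~ D (cell S s) p != 0.
    apply/existsP; apply: contraNT H; rewrite negb_exists => /forallP H.
    by rewrite big1 // => p _; have := H p; rewrite negbK => /eqP.
  exists p; first by apply: contraNneq np => ->; rewrite mulr0z.
  apply: term_coef_bd2_sub (valP p.1) (valP p.2) _.
  by apply: contraNneq np => ->; rewrite mul0rz.
have [p Dp [_ Ys]] := get set0 (sub0set _).
have [q Dq [Xs _]] := get [set x] (subxx _).
have uniq r : D (cell S s) r != 0 -> r = p.
  by move=> Dr; apply: (card_le1_eqP one); rewrite inE.
rewrite (uniq q Dq) in Xs.
have KE : K :|: [set x] = s by rewrite setUC setD1K.
rewrite KE in Xs; rewrite setU0 sK KE in Ys.
have := degD (exist _ s sS) p Dp; rewrite /sdim /= si /= => deg.
have arith (j k : nat) : (i < j)%N -> (i < k)%N -> (j.-1 + k.-1 = i + i)%N ->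
    (j <= i.+1)%N /\ (k <= i.+1)%N by clear; lia.
have := subset_leq_card Xs; have := subset_leq_card Ys; rewrite si => lY lX.
have [cX cY] := arith _ _ lX lY deg.
have EX : val p.1 = s by apply/esym/eqP; rewrite eqEcard Xs si cX.
have EY : val p.2 = s by apply/esym/eqP; rewrite eqEcard Ys si cY.
have ED : D (cell S s) = term S s s set0 *~ ((-1) ^+ cup_sign s s set0 (s :\: (s :|: set0))
    * D (cell S s) p).
  rewrite mulrzA /term mulrz_signK !setU0 setDv setU0.
  rewrite [LHS]chain2_sum (bigD1 p) //= big1 ?addr0 ?EX ?EY // => r nrp.
  by case: (eqVneq (D (cell S s) r) 0) => [->|/uniq E]; rewrite ?E ?eqxx // in nrp *.
move: ED; set c := _ * _ => ED.
(* Both boundaries are determined by the values on proper faces, where [D] and the cup agree;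
   comparing a non-zero coefficient gives [c] = 1. *)
have E : bd2 S (D (cell S s)) = bd2 S (cup S i set0 (cell S s)).
  have agr0 : agrees_on_faces i (cup S i set0) V s.
    move=> t tS ts.
    have ext (R : {set 'I_n.+1}) : R \subset t -> #|R| = i.+2 -> 
        (R \in (set0 : {set {set 'I_n.+1}})) = (R \in V).
      move=> Rt ci; have := leq_ltn_trans (subset_leq_card Rt) (proper_card ts).
      by rewrite ci si ltnNge leqnSn.
    by rewrite (cup_cell i set0 tS) (cup_simplex_ext S ext).
  rewrite (bd2_agrees HS homD sS agr).
  by rewrite (bd2_agrees HS (homotopy_cup HS (consistent0 S i.+1)) sS agr0).
have := coef set0 (sub0set _); rewrite ED; move: E.
rewrite ED cup_cell // (cup_simplex_top S _ si) raddfMz => E.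
have := congr1 (term_coef S s K set0) E; rewrite !raddfMz => {}E H.
have c1 : c = 1; last by rewrite c1 mulr1z.
move: H; rewrite E => H.
by apply: (mulfI H); rewrite mulr1 -mulrzz E.
Qed.

(** Each [L] is some [s :\ x], and its [A] is one bit: whether it contains [x]. Balance at a vertex
    of the square of [s :\ x :\ y] ties the bits of [x] and [y], which leaves one bit for [s]. *)
Lemma value_next : #|s| = i.+2 -> (nterms (D (cell S s)) <= 'C(#|s|, i.+1))%N ->
  D (cell S s) = cup_simplex S i [set s] s \/ D (cell S s) = cup_simplex S i set0 s.
Proof.
move=> si few.
have cs : (i.+2 <= #|s|)%N by rewrite si.
have [At [Asub _ E]] := value_shape HS homD sS agr cs few.
(* By the definition of [cupA], for a cup value this corrected bit says whether [s] belongs to the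
   consistent set. *)
pose b x := (x \in At (s :\ x)) (+) odd (card_gt (s :\ x) x).
have step x y : x \in s -> y \in s -> (x < y)%N -> b x = b y.
  move=> xs ys xy; have nxy : x != y by apply: contraTneq xy => ->; rewrite ltnn.
  pose L := s :\ x :\ y.
  have xL : x \notin L by rewrite !inE eqxx andbF.
  have yL : y \notin L by rewrite !inE eqxx.
  have EyL : y |: L = s :\ x by rewrite setD1K // !inE eq_sym nxy ys.
  have ExL : x |: L = s :\ y.
    apply/setP => z; rewrite !inE; have [->|_] := eqVneq z x; first by rewrite nxy xs.
    by [].
  have Ls : L \subset s by apply: subset_trans (subsetDl _ _) (subsetDl _ _).
  have Li : #|L| = i.
    by move: si; rewrite (cardsD1 x) xs -EyL cardsU1 yL => -[].
  have sL : s :\: L = x |: [set y].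
    apply/setP => z; rewrite !inE.
    have [->|_] := eqVneq z x; first by rewrite xs andbF.
    by have [->|_] := eqVneq z y; rewrite ?ys //=; case: (z \in s).
  have Qs : [set x] \subset s :\: L by rewrite sL subsetUl.
  have Q0 : [set x] != set0 by apply/set0Pn; exists x; rewrite inE.
  have Q1 : [set x] != s :\: L.
    by apply/eqP => /setP /(_ y); rewrite sL !inE eqxx orbT eq_sym (negPf nxy).
  have := vertex_balance HS homD sS agr Asub E Ls Li Qs Q0 Q1.
  rewrite sL big_setU1 ?inE //= big_set1 ExL EyL.
  have mx z : z \in edge_start s L x (At (s :\ y)) =
      (z == y) && ((y \in At (s :\ y)) (+) odd (card_gt L y)).
    rewrite inE setUC -setDDl sL !inE.
    have [->|zy] := eqVneq z y; first by rewrite eq_sym nxy orbT.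
    by case: (z =P x) => // ->.
  have my z : z \in edge_start s L y (At (s :\ x)) =
      (z == x) && ((x \in At (s :\ x)) (+) odd (card_gt L x)).
    rewrite inE setUC -setDDl sL !inE.
    have [->|zx] := eqVneq z x; first by rewrite nxy.
    by case: (z =P y) => // ->.
  have -> : ([set x] == edge_start s L x (At (s :\ y))) = false.
    by apply/eqP => /setP /(_ x); rewrite mx inE eqxx (negPf nxy).
  have -> : ([set x] == y |: edge_start s L y (At (s :\ x))) = false.
    by apply/eqP => /setP /(_ y); rewrite !in_setU1 eqxx inE eq_sym (negPf nxy).
  have -> : ([set x] == x |: edge_start s L x (At (s :\ y))) =
      ~~ ((y \in At (s :\ y)) (+) odd (card_gt L y)).
    apply/eqP/idP => [/setP /(_ y)|nb].
      by rewrite in_setU1 mx eqxx inE eq_sym (negPf nxy) /= => <-.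
    by apply/setP => z; rewrite in_setU1 mx (negPf nb) andbF orbF inE.
  have -> : ([set x] == edge_start s L y (At (s :\ x))) =
      (x \in At (s :\ x)) (+) odd (card_gt L x).
    apply/eqP/idP => [/setP /(_ x)|nb]; first by rewrite my eqxx inE eqxx /= => <-.
    by apply/setP => z; rewrite my nb andbT inE.
  have gx : card_gt (s :\ x) x = (card_gt L x).+1 by rewrite -EyL card_gtU1 // xy.
  have gy : card_gt (s :\ y) y = card_gt L y by rewrite -ExL card_gtU1 // ltnNge (ltnW xy).
  rewrite /b gx gy oddS; move: (x \in At _) (y \in At _) (odd _) (odd _).
  by do 4!case.
have [x0 x0s] : exists x, x \in s by apply/set0Pn; exact: (simplex_neq0 HS sS).
have const x : x \in s -> b x = b x0.
  move=> xs; have [xy|xy|/val_inj -> //] := ltngtP x x0; first exact: step.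
  by apply/esym; apply: step.
have cup_value (W : {set {set 'I_n.+1}}) : (s \in W) = b x0 ->
    D (cell S s) = cup_simplex S i W s.
  move=> sW; rewrite E cup_simplexE; apply: eq_bigr => L /andP[Ls /eqP Li]; congr term.
  have [x xs xL] : exists2 x, x \in s & x \notin L.
    have : (0 < #|s :\: L|)%N by rewrite cardsD (setIidPr Ls) Li si subSn // subnn.
    by rewrite card_gt0 => /set0Pn[x]; rewrite inE => /andP[xL xs]; exists x.
  have EL : L = s :\ x.
    apply/eqP; rewrite eqEcard subsetD1 Ls xL Li; move: si.
    rewrite (cardsD1 x) xs add1n => -[->].
    exact: leqnn.
  have As := Asub L Ls Li; apply/setP => z; have := subsetP As z.
  rewrite inE; have [zx|zx] := eqVneq z x; last first.
    rewrite EL !inE zx /= andNb => H; apply/negbTE/negP => /H; by [].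
  rewrite zx inE EL setD1K // sW -(const x xs) /b in_setD setD11 xs => _ /=.
  by case: (x \in At _); case: odd.
case Eb: (b x0); [left|right]; apply: cup_value; by rewrite Eb inE ?eqxx.
Qed.

(** If three facets alternate, the comparison of [x], [y], [z] is cyclic, and the three edges of the
    cube of [L] all go from singletons to pairs. One edge then starts at [set y] and none ends
    there, against [vertex_balance]. *)
Lemma value_consistent : #|s| = i.+3 -> D (cell S s) = cup_simplex S i V s ->
  beginning_segment V s \/ ending_segment V s.
Proof.
move=> si E; apply/segmentP => x y z xs ys zs /andP[xy yz].
have nxy : x != y by apply: contraTneq xy => ->; rewrite ltnn.
have nyz : y != z by apply: contraTneq yz => ->; rewrite ltnn.
have nxz : x != z by apply: contraTneq (ltn_trans xy yz) => ->; rewrite ltnn.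
have nyx : y != x by rewrite eq_sym.
have nzy : z != y by rewrite eq_sym.
have nzx : z != x by rewrite eq_sym.
pose L := s :\ x :\ y :\ z.
have Ls : L \subset s.
  by rewrite /L !setDDl subsetDl.
have memL a : a \in L = [&& a != z, a != y, a != x & a \in s] by rewrite !inE.
have Li : #|L| = i.
  move: si; rewrite (cardsD1 x) xs (cardsD1 y) !inE nyx ys.
  by rewrite (cardsD1 z) !inE nzy nzx zs => -[].
have sL : s :\: L = x |: (y |: [set z]).
  apply/setP => a; rewrite inE memL !inE.
  case: (a =P x) => [->|_]; first by rewrite xs !andbF.
  case: (a =P y) => [->|_]; first by rewrite ys !andbF.
  by case: (a =P z) => [->|_]; rewrite ?zs //=; case: (a \in s).
have Qs : [set y] \subset s :\: L by rewrite sL sub1set !inE eqxx orbT.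
have Q0 : [set y] != set0 by apply/set0Pn; exists y; rewrite inE.
have Q1 : [set y] != s :\: L.
  by apply/eqP => /setP /(_ x); rewrite sL !inE eqxx (negPf nxy).
have := vertex_balance HS homD sS agr (fun L _ _ => cupA_sub V s L) E Ls Li Qs Q0 Q1.
have xL : x \notin L by rewrite memL eqxx !andbF.
have yL : y \notin L by rewrite memL eqxx !andbF.
have zL : z \notin L by rewrite memL eqxx.
rewrite sL !big_setU1 ?inE ?negb_or ?nxy ?nxz // big_set1 /=.
rewrite !edge_start_cup // sL.
have Ez : x |: (y |: L) = s :\ z.
  apply/setP => a; rewrite !in_setU1 memL !inE.
  case: (a =P x) => [->|_]; first by rewrite nxz xs.
  by case: (a =P y) => [->|_]; first by rewrite nyz ys.
have Ey : x |: (z |: L) = s :\ y.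
  apply/setP => a; rewrite !in_setU1 memL !inE.
  case: (a =P x) => [->|_]; first by rewrite nxy xs.
  by case: (a =P z) => [->|_]; first by rewrite nzy zs.
have Ex : y |: (z |: L) = s :\ x.
  apply/setP => a; rewrite !in_setU1 memL !inE.
  case: (a =P y) => [->|_]; first by rewrite nyx ys.
  by case: (a =P z) => [->|_]; first by rewrite nzx zs.
have setE (P : {set 'I_n.+1}) : P \subset x |: (y |: [set z]) ->
    ([set y] == P) = [&& y \in P, x \notin P & z \notin P].
  move=> Ps; apply/eqP/and3P => [<-|[yP xP zP]].
    by rewrite !inE eqxx nxy nzy.
  apply/setP => a; rewrite inE; case: (a =P y) => [-> //|ny].
  symmetry; apply/negbTE/negP => aP; have := subsetP Ps a aP; rewrite !inE.
  by case/or3P => /eqP Ea; [move: xP | case: ny | move: zP]; rewrite -Ea ?aP.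
have sub1 (f : pred 'I_n.+1) : [set a in x |: (y |: [set z]) | f a] \subset x |: (y |: [set z]).
  by apply/subsetP => a; rewrite inE => /andP[].
have sub2 u (f : pred 'I_n.+1) : u \in x |: (y |: [set z]) ->
    u |: [set a in x |: (y |: [set z]) | f a] \subset x |: (y |: [set z]).
  by move=> uP; rewrite subUset sub1set uP sub1.
rewrite !setE ?sub1 ?sub2 ?inE ?eqxx ?orbT //.
rewrite /precedes !eqxx ?nxy ?nyz ?nxz ?nyx ?nzy ?nzx.
rewrite ?(setUCA [set y] [set x]) ?(setUCA [set z] [set x]) ?(setUCA [set z] [set y]).
rewrite Ex Ey Ez xy yz (ltn_trans xy yz) !ltnNge ?(ltnW xy) ?(ltnW yz) ?(ltnW (ltn_trans xy yz)).
by case: (s :\ x \in V); case: (s :\ y \in V); case: (s :\ z \in V); rewrite /= ?eqxx ?orbT ?andbF.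
Qed.

End SmallSimplices.

(** * Induction on the number of vertices *)

Theorem theorem4p6 (n : nat) (S : {set {set 'I_n.+1}}) (i : nat)
    (HS : simplicial_complex S) :
  (forall U : {set {set 'I_n.+1}}, consistent S i.+1 U ->
     homotopy_formula i (cup S i U)) /\
  (forall D : {additive chain S -> chain2 S},
     has_degree i D ->
     homotopy_formula i D ->
     (i = 0%N -> forall s, s \in simplices S 0 ->
        D (cell S s) = tensor (cell S s) (cell S s)) ->
     minimal_terms i D ->
     exists U : {set {set 'I_n.+1}},
       consistent S i.+1 U /\ (forall c : chain S, D c = cup S i U c)).
Proof.
split=> [U|D degD homD D0 minD]; first exact: homotopy_cup.
(* On a simplex [K] with i+2 vertices the cup value depends only on whether [K] is in the set, so
   [U] can be fixed before the induction by testing against [set K]. *)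
pose U : {set {set 'I_n.+1}} :=
  [set K in simplices S i.+1 | D (cell S K) == cup_simplex S i [set K] K].
have value s : s \in S -> D (cell S s) = cup_simplex S i U s.
  have [k] := ubnP #|s|; elim: k s => // k IHk s sk sS.
  have agr : agrees_on_faces i D U s.
    move=> t tS ts; apply: IHk => //.
    by apply: leq_trans (proper_card ts) _; rewrite -ltnS.
  (* By the induction hypothesis [D] and the cup of the empty set have equally many terms on each
     proper face, so [minimal_terms] applies at [s]. *)
  have few : (nterms (D (cell S s)) <= 'C(#|s|, i.+1))%N.
    have := minD _ (admissible_cup0 HS i) s sS; rewrite cup_cell // nterms_cup //.
    apply=> t tS ts; rewrite (cup_cell i set0 tS) (agr t tS ts); apply: eq_leq.
    exact: etrans (nterms_cup HS i set0 tS) (esym (nterms_cup HS i U tS)).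
  have [si|si|si] := ltngtP #|s| i.+1.
  (* Here the binomial bound is 0, so [D] vanishes on [s]. *)
  - rewrite cup_simplex_small //; move: few; rewrite bin_small // leqn0 cards_eq0 => /eqP E.
    apply/ffunP => p; apply/eqP; rewrite ffunE; apply: contraFT (in_set0 p) => Dp.
    by rewrite -E inE.
  - have [s2|s2] := eqVneq #|s| i.+2; last first.
      by apply: (value_large HS homD sS agr) => //; rewrite ltn_neqAle eq_sym s2.
    have ext (W : {set {set 'I_n.+1}}) : (s \in W) = (s \in U) ->
        cup_simplex S i W s = cup_simplex S i U s.
      move=> E; apply: cup_simplex_ext => K Ks Ki.
      by have -> : K = s by apply/eqP; rewrite eqEcard Ks Ki s2 leqnn.
    have [sU|sU] := boolP (s \in U).
      by move: (sU); rewrite inE => /andP[_ /eqP ->]; apply: ext; rewrite inE eqxx sU.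
    (* The first alternative would put [s] in [U] by the definition of [U]. *)
    have [E|->] := value_next HS homD sS agr s2 few.
      case/negP: sU; rewrite inE; apply/andP; split; last exact/eqP.
      by rewrite inE sS s2 eqxx.
    by apply: ext; rewrite inE (negPf sU).
  (* For i > 0 the bound is one term; for i = 0 the simplex is a point, where the value is
     prescribed. *)
  have [i0|i0] := posnP i; last first.
    by apply: (value_top HS homD sS agr) => //; move: few; rewrite si binn.
  have s0 : s \in simplices S 0 by rewrite inE sS si i0.
  by rewrite D0 // -(cup_vertex U s0) cup_cell // i0.
exists U; split; last first.
  apply: additive_cell_ext => [c d|c d|s sS]; [exact: raddfB | exact: raddfB |].
  by rewrite value // cup_cell.
split=> [|M]; first by apply/subsetP => K; rewrite inE => /andP[].
rewrite inE => /andP[MS /eqP Mi].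
apply: (@value_consistent _ _ HS i D homD) => //; last exact: value.
by move=> t tS _; apply: value.
Qed.
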